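(* Let $k \ge 1$ be an integer. There exists a constant $C > 0$ depending only on $k$ such that for every power $q$ of an odd prime, every integer $d > k$, every real $\alpha \ge C q^{(k-d)/(k+1)}$, and every set $A \subseteq \mathbf{F}_q^d$ with $|A| = \alpha q^d$, the set $A$ contains an isometric copy of every full rank $k$-simplex in $\mathbf{F}_q^d$; that is, for every full rank $k$-simplex $\Delta_k \subset \mathbf{F}_q^d$ there is a $k$-simplex $\Delta_k' \subseteq A$ with $\Delta_k' \simeq \Delta_k$.
   Context: $\mathbf{F}_q$ is the finite field with $q$ elements, of odd characteristic. For $v, w \in \mathbf{F}_q^d$, $v \cdot w := \sum_{i=1}^d v_i w_i \in \mathbf{F}_q$. A $k$-simplex in $\mathbf{F}_q^d$ is a set of $k+1$ points $\{v_0, v_1, \ldots, v_k\} \subseteq \mathbf{F}_q^d$ such that $v_1 - v_0, \ldots, v_k - v_0$ are linearly independent. To it one associates $V = \operatorname{Span}(v_1 - v_0, \ldots, v_k - v_0)$ and $V^\perp = \{w \in \mathbf{F}_q^d : v \cdot w = 0 \text{ for all } v \in V\}$; the rank of the simplex is $k - \dim(V \cap V^\perp)$, and the simplex is full rank if its rank is $k$, i.e. $V \cap V^\perp = \{0\}$. Two $k$-simplices $\Delta_k, \Delta_k'$ are isometric, written $\Delta_k \simeq \Delta_k'$, if they can be ordered $\Delta_k = \{v_0, \ldots, v_k\}$, $\Delta_k' = \{y_0, \ldots, y_k\}$ so that $(v_i - v_0)\cdot(v_j - v_0) = (y_i - y_0)\cdot(y_j - y_0)$ for all $1 \le i \le j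 \le k$. *)

(* Defs.v *)
From HB Require Import structures.
From mathcomp Require Import all_boot all_order all_algebra.

Set Implicit Arguments.
Unset Strict Implicit.
Unset Printing Implicit Defensive.

Import GRing.Theory.
Local Open Scope ring_scope.

Definition dot (F : finFieldType) (d : nat) (v w : 'rV[F]_d) : F :=
  \sum_(i < d) v 0 i * w 0 i.

(* The span only packages the finite set {w | v . w = 0 for all v in V} as a
   subspace: the two have the same elements, by mem_orthov. *)
Definition orthov (F : finFieldType) (d : nat) (V : {vspace 'rV[F]_d}) :
    {vspace 'rV[F]_d} :=
  <<enum [set w : 'rV[F]_d | [forall v in V, (dot v w == 0)%R]]>>%VS.

Definition edge (F : finFieldType) (d k : nat)
    (v : 'I_k.+1 -> 'rV[F]_d) (i : 'I_k) : 'rV[F]_d :=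
  v (lift ord0 i) - v ord0.

Definition edges (F : finFieldType) (d k : nat)
    (v : 'I_k.+1 -> 'rV[F]_d) : k.-tuple 'rV[F]_d :=
  [tuple edge v i | i < k].

Definition orders (F : finFieldType) (d k : nat)
    (v : 'I_k.+1 -> 'rV[F]_d) (S : {set 'rV[F]_d}) : Prop :=
  injective v /\ S = [set v i | i : 'I_k.+1].

Definition is_simplex (F : finFieldType) (d k : nat)
    (S : {set 'rV[F]_d}) : Prop :=
  exists2 v : 'I_k.+1 -> 'rV[F]_d, orders v S & free (edges v).

(* The truncated subtraction is exact for a simplex, where \dim V = k. *)
Definition simplex_rank (F : finFieldType) (d k : nat)
    (v : 'I_k.+1 -> 'rV[F]_d) : nat :=
  let V := <<edges v>>%VS in (k - \dim (V :&: orthov V))%N.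

(* By simplex_rank_orders, the choice of the ordering is immaterial. *)
Definition full_rank (F : finFieldType) (d k : nat)
    (S : {set 'rV[F]_d}) : Prop :=
  exists2 v : 'I_k.+1 -> 'rV[F]_d, orders v S & simplex_rank v = k.

Definition isometric (F : finFieldType) (d k : nat)
    (S S' : {set 'rV[F]_d}) : Prop :=
  exists v y : 'I_k.+1 -> 'rV[F]_d,
    [/\ orders v S, orders y S' &
        forall i j : 'I_k, (i <= j)%N ->
          dot (edge v i) (edge v j) = dot (edge y i) (edge y j)].

Lemma mem_orthov (F : finFieldType) (d : nat) (V : {vspace 'rV[F]_d})
    (w : 'rV[F]_d) :
  reflect (forall v, v \in V -> dot v w = 0) (w \in orthov V).
Proof.
apply: (iffP idP) => [+ v vV | orth_w].
  rewrite /orthov; set X := enum _ => wX.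
  rewrite (coord_span (wX : w \in <<in_tuple X>>%VS)).
  have dotX (i : 'I_(size X)) : dot v X`_i = 0.
    have : X`_i \in X by rewrite mem_nth.
    by rewrite mem_enum inE => /forall_inP/(_ v vV)/eqP.
  rewrite /dot; under eq_bigr do rewrite summxE mulr_sumr.
  rewrite exchange_big big1 // => i _.
  under eq_bigr do rewrite mxE mulrCA.
  by rewrite -mulr_sumr -/(dot _ _) dotX mulr0.
apply: memv_span; rewrite mem_enum inE.
by apply/forall_inP => v vV; apply/eqP; apply: orth_w.
Qed.

Lemma span_edges_orders (F : finFieldType) (d k : nat)
    (v y : 'I_k.+1 -> 'rV[F]_d) (S : {set 'rV[F]_d}) :
  orders v S -> orders y S -> <<edges v>>%VS = <<edges y>>%VS.
Proof.
suff sub : forall u t : 'I_k.+1 -> 'rV[F]_d, orders u S -> orders t S ->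
    (<<edges u>> <= <<edges t>>)%VS.
  by move=> vS yS; apply/eqP; rewrite eqEsubv !sub.
move=> u t [_ SE] [_ SE']; apply/span_subvP => x /mapP[i _ ->].
have mem0 z : z \in S -> z - t ord0 \in <<edges t>>%VS.
  rewrite SE' => /imsetP[j _ ->]; case: (unliftP ord0 j) => [l ->|->].
    by apply: memv_span; apply/mapP; exists l; rewrite ?mem_enum.
  by rewrite subrr mem0v.
rewrite /edge -(subrKA (t ord0)) -[t ord0 - _]opprB.
by apply: memvB; apply: mem0; rewrite SE imset_f.
Qed.

Lemma simplex_rank_orders (F : finFieldType) (d k : nat)
    (v y : 'I_k.+1 -> 'rV[F]_d) (S : {set 'rV[F]_d}) :
  orders v S -> orders y S -> simplex_rank v = simplex_rank y.
Proof. by move=> vS yS; rewrite /simplex_rank (span_edges_orders vS yS). Qed.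

(* Main.v *)
Require Import Defs.
From HB Require Import structures.
From mathcomp Require Import all_boot all_order all_fingroup all_algebra.
From mathcomp Require Import all_field all_character.
From mathcomp Require Import qpoly qfpoly.
From mathcomp Require Import reals exp.
From mathcomp Require Import zify ring lra.

Set Implicit Arguments.
Unset Strict Implicit.
Unset Printing Implicit Defensive.

Import Order.TTheory GRing.Theory Num.Theory.
Local Open Scope ring_scope.

(** Write [q = #|F|], let [v 0, ..., v (k - 1)] be the edge vectors of the given
    simplex, and call a copy of the first [n] of them a matrix [Y] with
    independent rows and the same Gram matrix. The theorem follows from a lower
    bound for the number of pairs [(x, Y)], [Y] a copy of all [k] vectors, with
    [x] and all [x + row j Y] in [A]. The bound is built up one vector at a time
    ([card_placed_ge]): the pairs for [n + 1] vectors come from the pairs for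
    [n] by adding a point [y] of the fibre of [Y], the set of vectors with the
    norm and the products with [Y] that [v n] prescribes. A fibre is a sphere in
    an affine space of dimension [d - n]; its size is of the order of
    [q ^ (d - n - 1)], and one expects a proportion [alpha] of them to satisfy [x + y \in A].

    The error in this expectation is controlled by the Cauchy-Schwarz inequality
    and the Parseval identity ([placed_discrepancy]): it is small if, for every
    nonzero [xi], the square of the character sum over the fibre of [Y] at [xi]
    is small on average over all copies [Y] ([second_moment]). The point is to
    bound this average without any information on the faces of the simplex,
    which may be degenerate although the simplex is not. By [fibre_sumE] the
    character sum over the fibre of [Y] is the Fourier transform, at the vector
    of products of [xi] with the rows of [Y], of a function of [c] that does not
    depend on [Y]. These products take no value much more often than in the
    uniform case ([card_slice_le]), so that the average is at most a constant
    times the mean square of that function, by Parseval again. Its values are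
    Gauss sums times Kloosterman or Salie sums, which exhibit square root
    cancellation for all [c] outside a quadric; at the last step this is exactly
    what is needed, while at the steps before it the trivial bound is enough.
    Nondegeneracy of the simplex enters through the ranks of the Gram matrices
    of its faces ([rank_gram_stack]), which give upper bounds for the size of
    spheres in affine spaces, and through a lower bound for the size of a fibre
    ([card_fibre_ge]).

    The bound for Kloosterman sums ([kloosterman_bound]) is proved by climbing a
    tower of quadratic extensions. Under a quadratic extension a Kloosterman sum
    [K] over a field with [Q] elements becomes [2 Q - K ^ 2]
    ([kloosterman_doubling]), so that a violation of [K ^ 2 <= 4 Q] gets worse at
    each stage without limit. On the other hand the sum over all twists of the
    Kloosterman sum counts the points of an Artin-Schreier curve, and a
    polynomial construction of Stepanov and Bombieri
    ([stepanov_twist_count]) shows that it is never very negative. *)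

(** * Additive characters and Fourier analysis *)

Section Characters.
Variable F : finFieldType.

Record addchar := AddChar {
  addchar_fun :> F -> algC;
  addcharD : {morph addchar_fun : x y / x + y >-> x * y};
  addchar_norm : forall x, `|addchar_fun x| = 1;
  addchar_nontriv : exists x, addchar_fun x != 1 }.

(** A finite abelian group has as many linear characters as elements, hence a
    nontrivial one. *)
Lemma addchar_exists : inhabited addchar.
Proof.
have abF : abelian [set: F]%G by exact: FinRing.zmod_abelian.
have /card_gt1P[i [j [_ _ nij]]] : (1 < #|Iirr [set: F]%G|)%N.
  rewrite card_ord NirrE.
  move: abF; rewrite card_classes_abelian => /eqP ->.
  by rewrite cardsT; apply: card_finRing_gt1.
have [l l0] : exists l : Iirr [set: F]%G, l != 0.
  by case: (eqVneq i 0) nij => [->|i0 _]; [rewrite eq_sym; exists j|exists i].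
have lin : 'chi_l \is a linear_char by move/char_abelianP: abF.
have nt : exists x, 'chi_l x != 1.
  apply/existsP; apply: contraR l0; rewrite negb_exists => /forallP h.
  apply/eqP/irr_inj/cfun_inP => x xF; rewrite irr0 cfun1E xF.
  by apply/eqP; move: (h x); rewrite negbK.
constructor; exists 'chi_l => //.
  by move=> x y; rewrite -FinRing.zmodMgE lin_charM ?inE.
by move=> x; rewrite normC_lin_char ?inE.
Qed.

End Characters.

(** The orthogonality relation behind every count below: translating by a
    point where the character is not 1 multiplies the sum by that value. *)
Lemma sum_char0 (V : finZmodType) (chi : V -> algC) (P : {pred V}) (w : V) :
    {morph chi : x y / x + y >-> x * y} ->
    (forall x, (x + w \in P) = (x \in P)) -> chi w != 1 ->
  \sum_(x in P) chi x = 0.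
Proof.
move=> chiD Pw w1; apply/eqP; set S := \sum_(x in P) _.
have : chi w * S = S.
  rewrite [RHS](reindex_inj (addIr w)) /= mulr_sumr.
  by apply: eq_big => [x|x _]; rewrite ?Pw // chiD mulrC.
move/eqP; rewrite -subr_eq0 -[X in _ - X]mul1r -mulrBl mulf_eq0 subr_eq0.
by rewrite (negPf w1).
Qed.

Section CharTheory.
Variables (F : finFieldType) (e : addchar F).
Local Notation q := (#|F|%:R : algC).

Lemma addchar_neq0 x : e x != 0.
Proof. by rewrite -normr_eq0 addchar_norm oner_eq0. Qed.

Lemma addchar0 : e 0 = 1.
Proof. by apply: (mulfI (addchar_neq0 0)); rewrite -addcharD addr0 mulr1. Qed.

Lemma addcharN x : e (- x) = (e x)^*.
Proof.
apply: (mulfI (addchar_neq0 x)).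
by rewrite -addcharD subrr addchar0 -normCK addchar_norm expr1n.
Qed.

Lemma addchar_sum (I : Type) (r : seq I) (P : pred I) (f : I -> F) :
  e (\sum_(i <- r | P i) f i) = \prod_(i <- r | P i) e (f i).
Proof. exact: (big_morph _ (addcharD e) addchar0). Qed.

Lemma addchar_scale_neq1 t : t != 0 -> exists b, e (b * t) != 1.
Proof.
have [x x1] := addchar_nontriv e.
by move=> t0; exists (x / t); rewrite divfK.
Qed.

Lemma sum_addcharM t : \sum_b e (b * t) = q * (t == 0)%:R.
Proof.
have [->|t0] := eqVneq t 0; last rewrite mulr0.
  by under eq_bigr do rewrite mulr0 addchar0; rewrite sumr_const mulr1.
have [b b1] := addchar_scale_neq1 t0.
rewrite (@sum_char0 F (fun b => e (b * t)) predT b) //.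
by move=> x y /=; rewrite mulrDl addcharD.
Qed.

Lemma sum_addchar_neq0 t : \sum_(b | b != 0) e (b * t) = q * (t == 0)%:R - 1.
Proof.
rewrite -sum_addcharM [X in X - 1](bigD1 0) //= mul0r addchar0.
by rewrite addrC addrK.
Qed.

End CharTheory.

Section Dot.
Variables (F : finFieldType) (d : nat).
Implicit Types u v w : 'rV[F]_d.

Lemma dotC u v : dot u v = dot v u.
Proof. by apply: eq_bigr => i _; rewrite mulrC. Qed.

Lemma dotDl u v w : dot (u + v) w = dot u w + dot v w.
Proof. by rewrite -big_split; apply: eq_bigr => i _; rewrite mxE mulrDl. Qed.

Lemma dotDr u v w : dot w (u + v) = dot w u + dot w v.
Proof. by rewrite !(dotC w) dotDl. Qed.

Lemma dotZl a u w : dot (a *: u) w = a * dot u w.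
Proof. by rewrite mulr_sumr; apply: eq_bigr => i _; rewrite mxE mulrA. Qed.

Lemma dotZr a u w : dot w (a *: u) = a * dot w u.
Proof. by rewrite !(dotC w) dotZl. Qed.

Lemma dot0l w : dot 0 w = 0.
Proof. by rewrite -(scale0r w) dotZl mul0r. Qed.

Lemma dot0r w : dot w 0 = 0.
Proof. by rewrite dotC dot0l. Qed.

Lemma dotNl u w : dot (- u) w = - dot u w.
Proof. by rewrite -scaleN1r dotZl mulN1r. Qed.

Lemma dotNr u w : dot w (- u) = - dot w u.
Proof. by rewrite !(dotC w) dotNl. Qed.

Lemma dotE u w : u *m w^T = (dot u w)%:M.
Proof.
apply/matrixP => i j; rewrite !ord1 !mxE eqxx mulr1n.
by apply: eq_bigr => l _; rewrite mxE.
Qed.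

Lemma mulmx_dot n (M : 'M[F]_(n, d)) w j :
  (w *m M^T) 0 j = dot w (row j M).
Proof. by rewrite !mxE; apply: eq_bigr => l _; rewrite !mxE. Qed.

Lemma dot_delta i w : dot (delta_mx 0 i) w = w 0 i.
Proof.
rewrite /dot (bigD1 i) //= big1 ?addr0 => [|j ji].
  by rewrite mxE !eqxx mul1r.
by rewrite mxE (negPf ji) andbF mul0r.
Qed.

Lemma dot_neq0 u : u != 0 -> exists w, dot w u != 0.
Proof.
move=> u0; have /existsP[i ui] : [exists i, u 0 i != 0].
  apply: contraR u0 => /existsPn h; apply/eqP/rowP => i; rewrite mxE.
  by apply/eqP; move: (h i); rewrite negbK.
by exists (delta_mx 0 i); rewrite dot_delta.
Qed.

End Dot.

Lemma dot_mulmx (F : finFieldType) (n d : nat) (c : 'rV[F]_n) (M : 'M[F]_(n, d)) (w : 'rV_d) :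
  dot (c *m M) w = dot c (w *m M^T).
Proof.
have := dotE (c *m M) w; have -> : c *m M *m w^T = c *m (w *m M^T)^T.
  by rewrite trmx_mul trmxK mulmxA.
by rewrite dotE => /matrixP/(_ 0 0); rewrite !mxE eqxx !mulr1n.
Qed.


Definition dot_linear := (dotDl, dotDr, dotZl, dotZr, dotNl, dotNr).

Section Fourier.
Variables (F : finFieldType) (e : addchar F) (d : nat).
Local Notation q := (#|F|%:R : algC).
Local Notation V := 'rV[F]_d.

Lemma card_rV : #|{: V}| = (#|F| ^ d)%N.
Proof. by rewrite card_mx mul1n. Qed.

Lemma sum_char_dot (u : V) : \sum_(x : V) e (dot x u) = q ^+ d * (u == 0)%:R.
Proof.
have [->|u0] := eqVneq u 0; last rewrite mulr0.
  under eq_bigr do rewrite dot0r addchar0.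
  by rewrite sumr_const card_rV mulr1 natrX.
have [w wu] := dot_neq0 u0.
have [b b1] := addchar_scale_neq1 e wu.
rewrite (@sum_char0 _ (fun x : V => e (dot x u)) predT (b *: w)) //.
  by move=> x y /=; rewrite dotDl addcharD.
by rewrite dotZl.
Qed.

Definition fourier (f : V -> algC) (xi : V) : algC :=
  \sum_x f x * e (dot x xi).

Lemma parseval (f : V -> algC) :
  \sum_xi `|fourier f xi| ^+ 2 = q ^+ d * \sum_x `|f x| ^+ 2.
Proof.
transitivity (\sum_x \sum_y f x * (f y)^* * \sum_xi e (dot xi (x - y))).
  under [RHS]eq_bigr => x _ do under eq_bigr do rewrite mulr_sumr.
  under [RHS]eq_bigr => x _ do rewrite exchange_big.
  rewrite [RHS]exchange_big; apply: eq_bigr => xi _.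
  rewrite normCK rmorph_sum mulr_suml; apply: eq_bigr => x _.
  rewrite mulr_sumr; apply: eq_bigr => y _.
  rewrite rmorphM /= -addcharN mulrACA -addcharD.
  by congr (_ * e _); rewrite dotC [dot y _]dotC dotDr dotNr.
rewrite mulr_sumr; apply: eq_bigr => x _.
rewrite (bigD1 x) //= [X in _ + X]big1 ?addr0 => [|y yx].
  by rewrite sum_char_dot subrr eqxx mulr1 normCK mulrC.
by rewrite sum_char_dot subr_eq0 eq_sym (negPf yx) !mulr0.
Qed.

End Fourier.

(** * Stepanov's method for an Artin-Schreier curve *)

Section SeparableNotSquare.
Variable L : fieldType.
Implicit Types f A D : {poly L}.

(** In lowest terms the denominator is constant, so that [f] would be a
    constant times a square. *)
Lemma separable_not_square_ratio f A D :
  separable_poly f -> (1 < size f)%N -> A ^+ 2 = f * D ^+ 2 -> D = 0.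
Proof.
move=> sep_f size_f eqAD; apply/eqP/negP => /negP D0.
have f0 : f != 0 by rewrite -size_poly_gt0 (ltn_trans _ size_f).
pose g := gcdp A D; have g0 : g != 0 by rewrite gcdp_eq0 (negPf D0) andbF.
have [A' A'E] : exists A', A = A' * g by apply/dvdpP/dvdp_gcdl.
have [D' D'E] : exists D', D = D' * g by apply/dvdpP/dvdp_gcdr.
have cop : coprimep A' D'.
  have := coprimep_div_gcd (p := A) (q := D); rewrite D0 orbT => /(_ isT).
  by rewrite -/g {1}A'E {1}D'E !mulpK.
have eqAD' : A' ^+ 2 = f * D' ^+ 2.
  apply: (mulIf (expf_neq0 2 g0)).
  by transitivity (A ^+ 2); [rewrite A'E|rewrite eqAD D'E]; ring.
have cop2 : coprimep (D' ^+ 2) (A' ^+ 2).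
  by rewrite coprimep_expl ?coprimep_expr // coprimep_sym.
have D'1 : D' ^+ 2 %| 1.
  by rewrite -(Gauss_dvdpr _ cop2) mulr1 eqAD' dvdp_mulIr.
have A'f : A' ^+ 2 %| f.
  by move: cop2; rewrite coprimep_sym => /Gauss_dvdpl <-; rewrite -eqAD'.
have [A'1|A'1] := eqVneq (size A') 1%N; last first.
  by move: A'f; rewrite (separable_nosquare sep_f).
have : size (A' ^+ 2) = size f.
  rewrite eqAD'; move: D'1; rewrite dvdp1 => /size_poly1P[c c0 ->].
  by rewrite mulrC size_Cmul.
move: A'1; move/eqP/size_poly1P => [c c0 ->].
by rewrite -rmorphXn size_polyC expf_neq0 //= => f1; rewrite -f1 in size_f.
Qed.

End SeparableNotSquare.

Section Stepanov.
Variables (L : finFieldType) (p q u : nat).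
Local Notation s := (2 * u + 1)%N.
Hypothesis charL : p \in [pchar L].
Hypothesis p_s : p.-nat s.
Hypothesis cardL : #|L| = (s ^ 2)%N.
Hypothesis q0 : q%:R = 0 :> L.
Hypothesis L2 : 2%:R != 0 :> L.
Hypotheses (q_ge3 : (2 < q)%N) (q_le_s : (q * q <= s)%N).
Variables (a delta : L).
Hypotheses (a0 : a != 0) (delta0 : delta != 0).

Let LD (x y : L) : (x + y) ^+ s = x ^+ s + y ^+ s.
Proof.
by apply: exprDn_pchar; apply: sub_in_pnat p_s => r _ /eqP ->.
Qed.

Let LDp (x y : {poly L}) : (x + y) ^+ s = x ^+ s + y ^+ s.
Proof.
apply: exprDn_pchar; apply: sub_in_pnat p_s => r _ /eqP ->.
by rewrite pchar_poly.
Qed.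

Let f : {poly L} := delta^-1 *: (('X^q - 'X) ^+ 2 - a%:P).
(** For the Frobenius power [s = 2 u + 1], this is [f ^ ((s + 1) / 2)]. *)
Let G := f ^+ u.+1.

Lemma size_f : size f = (2 * q + 1)%N.
Proof.
rewrite size_scale ?invr_neq0 //.
have sX : size ('X^q - 'X : {poly L}) = q.+1.
  by rewrite size_polyDl ?size_polyXn // size_polyN size_polyX; lia.
have sX2 : size (('X^q - 'X : {poly L}) ^+ 2) = (2 * q + 1)%N.
  by have := size_exp ('X^q - 'X : {poly L}) 2; rewrite sX /=; case: (size _) => [|n] /= h; lia.
by rewrite size_polyDl sX2 // size_polyN size_polyC; lia.
Qed.

Lemma separable_f : separable_poly f.
Proof.
have df : f^`() = - (2%:R * delta^-1) *: ('X^q - 'X).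
  have qX : 'X^(q.-1) *+ q = 0 :> {poly L}.
    by rewrite -mulr_natr -(polyC_natr L q) q0 mulr0.
  rewrite derivZ derivB derivC subr0 deriv_exp derivB derivXn derivX /= qX.
  by rewrite sub0r expr1 -!mul_polyC !polyCN polyCM polyC_natr; ring.
rewrite unlock; apply/Bezout_eq1_coprimepP.
exists ((- (delta / a))%:P, (- (delta / (2%:R * a)))%:P * ('X^q - 'X)) => /=.
rewrite df /f -!mul_polyC.
pose x : {poly L} := 'X^q - 'X; rewrite -/x.
transitivity ((delta / a * delta^-1 * a)%:P +
  (- (delta / a * delta^-1) +
    delta / (2%:R * a) * (2%:R * delta^-1))%:P * x ^+ 2 : {poly L}).
  by rewrite !(polyCD, polyCN, polyCM); ring.
have -> : - (delta / a * delta^-1) + delta / (2 * a) * (2 / delta) = 0.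
  by field; rewrite a0 L2 delta0.
have -> : delta / a * delta^-1 * a = 1 by field; rewrite a0 delta0.
by rewrite mul0r addr0.
Qed.

(** As [G ^ 2 = f * f ^ s] and [f ^ s] is constant modulo ['X^s], squaring the
    relation gives [A ^ 2 = c f D ^ 2] modulo ['X^s], hence exactly because both
    sides have degree less than [s]; but [f] is separable. *)
Lemma combination_head (A D R : {poly L}) :
  (size A <= u.+1)%N -> (size D <= u.+1 - q)%N ->
  A + G * D = R * 'X^s -> A = 0 /\ D = 0.
Proof.
move=> sA sD eqAD; pose c := f.[0] ^+ s.
have [f1 f1E] : exists f1, f = f1 * 'X + (f.[0])%:P.
  have /factor_theorem[f1 f1E] : root (f - (f.[0])%:P) 0.
    by rewrite /root !hornerE subrr.
  by exists f1; rewrite -[LHS](subrK (f.[0])%:P) f1E subr0.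
have fs : f ^+ s = f1 ^+ s * 'X^s + c%:P.
  by rewrite {1}f1E LDp exprMn -rmorphXn.
have G2 : G ^+ 2 = f * f ^+ s by rewrite -exprM -exprS; congr (_ ^+ _); lia.
have c0 : c != 0.
  rewrite /c; have -> : f.[0] = - (delta^-1 * a).
    rewrite !(hornerE, horner_exp) expr0n (_ : q == 0%N = false); last by lia.
    by rewrite subrr expr0n /= sub0r mulrN.
  by rewrite expf_neq0 // oppr_eq0 mulf_neq0 ?invr_neq0.
have size_fD : (size (f * D ^+ 2)%R <= s)%N.
  apply: leq_trans (size_polyMleq _ _) _; rewrite size_f.
  have := size_poly_exp_leq D 2; have : (q <= u)%N by nia.
  by case: (size D) sD; lia.
have size_A2 : (size (A ^+ 2)%R <= s)%N.
  by apply: leq_trans (size_poly_exp_leq A 2) _; case: (size A) sA; lia.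
have eq2 : A ^+ 2 = (c *: f) * D ^+ 2.
  apply/eqP; rewrite -subr_eq0; apply: contraTT (leqnn s) => P0.
  rewrite -ltnNge -(size_polyXn L s).
  apply: leq_trans (dvdp_leq P0 _) _; last first.
    rewrite -scalerAl; apply: leq_trans (size_polyD _ _) _.
    by rewrite size_polyN size_scale // geq_max size_A2.
  apply/dvdpP; exists (R ^+ 2 * 'X^s - 2%:R * R * G * D + f * f1 ^+ s * D ^+ 2).
  have -> : A = R * 'X^s - G * D by rewrite -eqAD addrK.
  rewrite -mul_polyC.
  transitivity ((R ^+ 2 * 'X^s - 2%:R * R * G * D) * 'X^s +
     (G ^+ 2 - c%:P * f) * D ^+ 2); first by ring.
  by rewrite G2 fs; ring.
have D0 : D = 0.
  apply: separable_not_square_ratio eq2.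
    by rewrite (eqp_separable (eqp_scale f c0)) separable_f.
  by rewrite size_scale // size_f; lia.
by split=> //; apply/eqP; move: eq2; rewrite D0 expr0n mulr0 => /eqP; rewrite expf_eq0.
Qed.

Lemma combination_free M (A D : nat -> {poly L}) :
  (forall m, size (A m) <= u.+1)%N -> (forall m, size (D m) <= u.+1 - q)%N ->
  \sum_(m < M) (A m + G * D m) * 'X^(m * s) = 0 ->
  forall m, (m < M)%N -> A m = 0 /\ D m = 0.
Proof.
elim: M A D => [|M IH] A D sA sD; first by [].
rewrite big_ord_recl mul0n expr0 mulr1.
under eq_bigr do rewrite lift0 mulSn addnC exprD mulrA.
rewrite -mulr_suml => eq0.
have [A0 D0] : A 0%N = 0 /\ D 0%N = 0.
  apply: combination_head (sA 0%N) (sD 0%N) _.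
  by move/(canRL (addrK _)): eq0; rewrite sub0r -mulNr; exact.
move: eq0; rewrite A0 D0 mulr0 !add0r => /eqP; rewrite mulf_eq0.
rewrite [X in _ || X]expf_eq0 polyX_eq0 andbF orbF => /eqP eq0 [|m] //= lt_m.
exact: (IH (fun m => A m.+1) (fun m => D m.+1)).
Qed.

Let Frs (P : {poly L}) := map_poly (fun x => x ^+ s) P.

(** As [#|L| = s ^ 2], raising to the power [s] twice is the identity. *)
Lemma horner_Frs P w : (Frs P).[w] ^+ s = (P \Po 'X^s).[w].
Proof.
rewrite /Frs /map_poly horner_poly horner_comp hornerXn horner_coef.
elim/big_rec2: _ => [|i x y _ <-]; first by rewrite expr0n addn1.
rewrite LD; congr (_ + _); rewrite exprMn exprAC -!exprM mulnn -cardL.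
by rewrite expf_card.
Qed.

Lemma Frs_eq0 P : Frs P = 0 -> P = 0.
Proof.
move=> P0; apply/polyP => i; have := congr1 (fun Q : {poly L} => Q`_i) P0.
rewrite coef_map_id0 ?expr0n ?addn1 // coef0 => /eqP.
by rewrite expf_eq0 /= => /eqP.
Qed.

Lemma size_Frs P : (size (Frs P) <= size P)%N.
Proof. exact: size_poly. Qed.

Let M := (u.+1 + q)%N.

(** There are more coefficients to choose than coefficients of the result, so
    that two different choices have the same result; take their difference. *)
Lemma kernel_exists :
  exists A D : nat -> {poly L},
  [/\ forall m, (size (A m) <= u.+1)%N, forall m, (size (D m) <= u.+1 - q)%N,
      exists2 m, (m < M)%N & (A m != 0) || (D m != 0) &
      \sum_(m < M) ((A m \Po 'X^s) + (D m \Po 'X^s) * G) * 'X^m = 0].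
Proof.
pose T := ('M[L]_(M, u.+1) * 'M[L]_(M, u.+1 - q))%type.
pose phi (x : T) : {poly L} := \sum_(m < M) ((rVpoly (row m x.1) \Po 'X^s) +
  (rVpoly (row m x.2) \Po 'X^s) * G) * 'X^m.
(* As [u.+1 - q] is [q] less than [u.+1] and [G] has degree [q * (s + 1)], both
   parts of [phi] have size at most [E]. *)
pose E := (s * u + q + M)%N.
have size_comp n (P : {poly L}) : (size P <= n.+1)%N ->
    (size (P \Po 'X^s) <= n * s + 1)%N.
  move=> sP; apply: leq_trans (size_comp_poly_leq _ _) _.
  by rewrite size_polyXn /= -addn1 leq_add2r leq_mul2r; case: (size P) sP; lia.
have size_phi x : (size (phi x) <= E)%N.
  apply: leq_trans (size_sum _ _ _) _; apply/bigmax_leqP => m _.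
  rewrite (leq_trans (size_polyMleq _ _)) // size_polyXn addnS /=.
  have := ltn_ord m; rewrite /E.
  suff : (size (((rVpoly (row m x.1) \Po 'X^s) +
      (rVpoly (row m x.2) \Po 'X^s) * G))%R <= s * u + q + 1)%N.
    by move: (size _) (s * u + q)%N (val m) => z b i /=; lia.
  apply: leq_trans (size_polyD _ _) _; rewrite geq_max; apply/andP; split.
    by apply: leq_trans (size_comp u _ (size_poly _ _)) _; lia.
  apply: leq_trans (size_polyMleq _ _) _.
  have sG : (size G <= 2 * q * u.+1 + 1)%N.
    by apply: leq_trans (size_poly_exp_leq _ _) _; rewrite size_f; lia.
  have le_qu : (q <= u)%N by nia.
  have := size_comp (u - q)%N (rVpoly (row m x.2)); rewrite -subSn //.
  move=> /(_ (size_poly _ _)); move: sG; move: (size _) (size _) => y z; nia.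
pose psi x : 'rV[L]_E := poly_rV (phi x).
have [x [y [nxy eqxy]]] : exists x y : T, x != y /\ psi x = psi y.
  suff /injectivePn[x [y nxy eqxy]] : ~~ injectiveb psi by exists x, y.
  apply/negP => /injectiveP/leq_card; rewrite card_prod !card_mx -expnD mul1n.
  rewrite leq_exp2l; last by rewrite cardL; nia.
  by rewrite /E /M; apply/negP; rewrite -ltnNge; nia.
have phiB : phi (x.1 - y.1, x.2 - y.2) = 0.
  transitivity (phi x - phi y); last first.
    have := congr1 rVpoly eqxy; rewrite /psi !poly_rV_K // => ->.
    by rewrite subrr.
  rewrite /phi -sumrB; apply: eq_bigr => m _ /=.
  by rewrite !linearB /=; ring.
exists (fun m => rVpoly (row (inord m) (x.1 - y.1))).
exists (fun m => rVpoly (row (inord m) (x.2 - y.2))).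
split=> [m|m||]; try exact: size_poly; last first.
  by rewrite -[RHS]phiB; apply: eq_bigr => m _ /=; rewrite !inord_val.
have [/forallP h|/forallPn[m]] := boolP [forall m : 'I_M,
    (rVpoly (row m (x.1 - y.1)) == 0) && (rVpoly (row m (x.2 - y.2)) == 0)].
  case/negP: nxy; apply/eqP; case: x y h {eqxy phiB} => x1 x2 [y1 y2] /= h.
  by congr (_, _); apply/eqP; rewrite -subr_eq0; apply/eqP/row_matrixP => m;
    have /andP[/eqP h1 /eqP h2] := h m; rewrite linear0;
    apply: (can_inj rVpolyK); rewrite linear0.
by rewrite negb_and => hm; exists m; rewrite // inord_val.
Qed.

(** The counted [w] are those for which [f.[w]] is a square; for these
    [G.[w] ^+ s = G.[w]], since [#|L| = s ^ 2]. Hence the [s]-th power of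
    [h.[w]] is the value at [w] of a combination that vanishes identically, so
    that all these [w] are roots of [h]. The combination being nontrivial, [h] is
    not zero, and its degree is about [#|L| / 2]. *)
Lemma stepanov_twist_count :
  (#|[set w : L | [exists z : L, ((w ^+ q - w) ^+ 2 - a == delta * z ^+ 2)%R]]|
     <= u * (s + 1) + 2 * q * s)%N.
Proof.
have [A [D [sA sD [m0 lt_m0 nz] eq0]]] := kernel_exists.
pose h := \sum_(m < M) (Frs (A m) + G * Frs (D m)) * 'X^(m * s).
have h0 : h != 0.
  apply: contraL nz => /eqP h0; rewrite negb_or !negbK.
  have [] // := combination_free (A := fun m => Frs (A m))
    (D := fun m => Frs (D m)) _ _ h0 lt_m0.
  - by move=> m; apply: leq_trans (size_Frs _) (sA m).
  - by move=> m; apply: leq_trans (size_Frs _) (sD m).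
  by move=> /Frs_eq0-> /Frs_eq0->; rewrite eqxx.
have size_h : (size h <= (u * (s + 1) + 2 * q * s).+1)%N.
  apply: leq_trans (size_sum _ _ _) _; apply/bigmax_leqP => m _.
  rewrite (leq_trans (size_polyMleq _ _)) // size_polyXn addnS /=.
  have lt_m : (m < u.+1 + q)%N := ltn_ord m.
  have : (m * s <= (u + q) * s)%N by rewrite leq_mul2r; lia.
  suff : (size (Frs (A m) + G * Frs (D m))%R <= u + q * s + 1)%N.
    by move: (size _) (nat_of_ord m * s)%N => z y; nia.
  apply: leq_trans (size_polyD _ _) _; rewrite geq_max; apply/andP; split.
    by apply: leq_trans (size_Frs _) _; apply: leq_trans (sA m) _; lia.
  apply: leq_trans (size_polyMleq _ _) _.
  have sG : (size G <= 2 * q * u.+1 + 1)%N.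
    by apply: leq_trans (size_poly_exp_leq _ _) _; rewrite size_f; lia.
  have le_qu : (q <= u)%N by nia.
  have := leq_trans (size_Frs _) (sD m); move: sG.
  by move: (size _) (size _) => y z; nia.
rewrite -ltnS cardE; apply: leq_trans size_h.
apply: max_poly_roots => //; last exact: enum_uniq.
apply/allP => w; rewrite mem_enum inE => /existsP[z /eqP wz].
have fw : f.[w] = z ^+ 2.
  by rewrite !(hornerE, horner_exp) wz mulKf.
have Gs : G.[w] ^+ s = G.[w].
  rewrite horner_exp fw; transitivity (z ^+ (s ^ 2 + s)).
    by rewrite -!exprM; congr (_ ^+ _); rewrite expnS expn1; nia.
  by rewrite exprD -cardL expf_card -exprS -exprM; congr (_ ^+ _); lia.
suff : h.[w] ^+ s = 0 by move/eqP; rewrite expf_eq0 => /andP[].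
have <- : (\sum_(m < M) ((A m \Po 'X^s) + (D m \Po 'X^s) * G) * 'X^m).[w] = 0.
  by rewrite eq0 horner0.
rewrite !horner_sum; elim/big_rec2: _ => [|m x y _ <-].
  by rewrite expr0n addn1.
rewrite LD !(hornerM, hornerD, hornerXn); congr (_ + _); rewrite exprMn LD exprMn.
by rewrite Gs !horner_Frs [G.[w] * _]mulrC -exprM -mulnA mulnn -cardL mulnC exprM expf_card.
Qed.

End Stepanov.

(** * Square roots and quadratic extensions *)

Section SquareRoots.
Variable F : finFieldType.
Hypothesis F2 : 2%:R != 0 :> F.

Definition nsqrt (D : F) := #|[set y | y ^+ 2 == D]|.

Let opp_neq (y : F) : y != 0 -> - y != y.
Proof.
by move=> y0; rewrite eq_sym -subr_eq0 opprK -mulr2n -mulr_natr mulf_neq0.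
Qed.

Lemma nsqrt0 : nsqrt 0 = 1%N.
Proof.
rewrite -(cards1 (0 : F)) /nsqrt; apply: eq_card => y.
by rewrite !inE expf_eq0.
Qed.

Lemma nsqrt_sqr y : y != 0 -> nsqrt (y ^+ 2) = 2%N.
Proof.
move=> y0; transitivity #|[set y; - y]|; last by rewrite cards2 eq_sym opp_neq.
by apply: eq_card => z; rewrite !inE eqf_sqr.
Qed.

Lemma nsqrt_gt0 D : (0 < nsqrt D)%N -> exists y, D = y ^+ 2.
Proof. by move=> /card_gt0P[y]; rewrite inE => /eqP <-; exists y. Qed.

Lemma nsqrt_le2 D : (nsqrt D <= 2)%N.
Proof.
have [//|/nsqrt_gt0[y ->]] := posnP (nsqrt D); first by move->.
by have [->|/nsqrt_sqr->//] := eqVneq y 0; rewrite expr0n /= nsqrt0.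
Qed.

Lemma sum_nsqrt (R : nmodType) (phi : F -> R) :
  \sum_y phi (y ^+ 2) = \sum_D phi D *+ nsqrt D.
Proof.
rewrite (partition_big (fun y => y ^+ 2) xpredT) //=; apply: eq_bigr => D _.
rewrite (eq_bigr (fun=> phi D)) => [|y /eqP->//].
by rewrite -sumr_const; apply: eq_bigl => y; rewrite inE.
Qed.

Lemma sum_nsqrt_card : (\sum_D nsqrt D = #|F|)%N.
Proof.
rewrite -sum1_card [RHS](partition_big (fun y : F => y ^+ 2) xpredT) //=.
apply: eq_bigr => D _; rewrite /nsqrt -sum1_card.
by apply: eq_bigl => y; rewrite inE.
Qed.

Lemma nonsquare_exists : exists delta : F, nsqrt delta = 0%N.
Proof.
have [/existsP[delta /eqP d0]|/existsPn h] := boolP [exists D, nsqrt D == 0%N].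
  by exists delta.
have := sum_nsqrt_card; rewrite (bigD1 1) //= -(expr1n F 2).
rewrite nsqrt_sqr ?oner_eq0 // expr1n => card_eq.
have : (\sum_(i : F | i != 1%R) 1 <= \sum_(i | i != 1%R) nsqrt i)%N.
  by apply: leq_sum => i _; rewrite lt0n h.
rewrite sum1_card cardC1 -card_eq; by move: (\sum_(_ | _) _)%N => S; lia.
Qed.

(** No nonzero [D] has both [D] and [D / delta] square, so each sum on the left is
    at most 2; as the total over all [D] is [2 * #|F|], equality holds for all. *)
Lemma nonsquare_dichotomy delta D :
  nsqrt delta = 0%N -> (nsqrt D + nsqrt (D / delta) = 2)%N.
Proof.
move=> dns; have d0 : delta != 0 by apply: contra_eq_neq dns => ->; rewrite nsqrt0.
have le2 E : (nsqrt E + nsqrt (E / delta) <= 2)%N.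
  have [->|/nsqrt_gt0[y Ey]] := posnP (nsqrt E); first exact: nsqrt_le2.
  have [->|/nsqrt_gt0[z Ez]] := posnP (nsqrt (E / delta)).
    by rewrite addn0 nsqrt_le2.
  have [z0|z0] := eqVneq z 0.
    move: Ez; rewrite z0 expr0n /= => /eqP.
    by rewrite mulf_eq0 invr_eq0 (negPf d0) orbF => /eqP->; rewrite mul0r nsqrt0.
  move: dns; suff -> : delta = (y / z) ^+ 2.
    by rewrite nsqrt_sqr // mulf_neq0 ?invr_eq0 // -sqrf_eq0 -Ey;
      apply: contraNneq z0 => E0; rewrite -sqrf_eq0 -Ez E0 mul0r.
  rewrite expr_div_n -Ey -Ez invf_div mulrC divfK //.
  by apply: contraNneq z0 => E0; rewrite -sqrf_eq0 -Ez E0 mul0r.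
have total : (\sum_E (nsqrt E + nsqrt (E / delta)) = \sum_(E : F) 2)%N.
  have shift : (\sum_E nsqrt (E / delta) = \sum_E nsqrt E)%N.
    by rewrite [RHS](reindex_inj (mulIf (invr_neq0 d0))).
  rewrite big_split /= shift.
  by rewrite sum_nsqrt_card sum_nat_const muln2 addnn.
apply/eqP; rewrite eqn_leq le2 /= leqNgt; apply/negP => lt2.
have : (\sum_E (nsqrt E + nsqrt (E / delta)) < \sum_(E : F) 2)%N.
  rewrite (bigD1 D) //= [X in (_ < X)%N](bigD1 D) //=.
  by rewrite -addSn leq_add // leq_sum.
by rewrite total ltnn.
Qed.

Lemma four_neq0 : 4%:R != 0 :> F.
Proof. by rewrite (natrM _ 2 2) mulf_neq0. Qed.

(** The left side counts the roots of ['X^2 - t 'X + C]. *)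
Lemma card_sum_roots C t : C != 0 ->
  #|[set x : F | (x != 0) && (x + C / x == t)]| = nsqrt (t ^+ 2 - 4%:R * C).
Proof.
move=> C0; pose h y := (t + y) / 2%:R.
have h_inj : injective h by move=> y z /(mulIf (invr_neq0 F2))/addrI.
rewrite /nsqrt -[RHS](card_imset _ h_inj); apply: eq_card => x.
rewrite inE; apply/andP/imsetP => [[x0 /eqP tE]|[y]].
  exists (2%:R * x - t); last by rewrite /h; field.
  by rewrite inE -tE; apply/eqP; field.
rewrite inE => /eqP yD ->.
have prod_C : (t + y) * (t - y) = 4%:R * C.
  by rewrite mulrC -subr_sqr yD opprB addrC subrK.
have ty0 : t + y != 0.
  apply: contra_neq C0 => ty; move: prod_C; rewrite ty mul0r => /esym/eqP.
  by rewrite mulf_eq0 (negPf four_neq0) => /eqP.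
split; first by rewrite /h mulf_neq0 ?invr_neq0.
have -> : C = (t + y) * (t - y) / 4%:R by rewrite prod_C mulrC mulKf ?four_neq0.
by rewrite /h; apply/eqP; field; rewrite ty0 F2 ?four_neq0.
Qed.

Lemma sum_diff_bij : bijective (fun z : F * F => (z.1 + z.2, z.1 - z.2)).
Proof.
by exists (fun z : F * F => ((z.1 + z.2) / 2%:R, (z.1 - z.2) / 2%:R)) => -[x y];
  rewrite /=; congr (_, _); field.
Qed.

End SquareRoots.

Lemma quadratic_extension (F : finFieldType) (delta : F) :
    nsqrt delta = 0%N ->
  exists (L : finFieldType) (iota : {rmorphism F -> L}) (w : L),
    w ^+ 2 = iota delta /\ #|L| = (#|F| ^ 2)%N.
Proof.
move=> nsq; pose h : {poly F} := 'X^2 - delta%:P.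
have size_h : size h = 3 by rewrite /h size_polyDl size_polyXn // size_polyN size_polyC; case: eqP.
have h_monic : h \is monic.
  by rewrite monicE lead_coefE size_h /h coefB coefXn coefC subr0.
have h_irr : irreducible_poly h.
  apply: cubic_irreducible; rewrite ?size_h // => x; apply/negP.
  rewrite /root !(hornerE, horner_exp) subr_eq0 => hx.
  by move: nsq => /eqP; rewrite cards_eq0 => /eqP/setP/(_ x); rewrite !inE hx.
pose hI : monic_irreducible_poly h := (h_irr, h_monic).
pose L : finFieldType := {poly %/ h with hI}.
exists L, (in_alg L), ('qX : {poly %/ h}); split; last first.
  by rewrite card_qfpoly size_h.
have h_qpoly : in_qpoly h h = 0.
  by apply: val_inj => /=; rewrite (mk_monicE hI) Pdiv.RingMonic.rmodpp.
have : in_qpoly h ('X * 'X - delta *: 1) = 0.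
  by rewrite -expr2 scale_polyC mulr1.
rewrite linearB linearZ /= in_qpolyM => /eqP; rewrite subr_eq0 => /eqP.
by rewrite in_qpoly1.
Qed.

(** * Kloosterman sums under a quadratic extension *)

Definition kloosterman (K : finFieldType) (phi : K -> algC) (a : K) : algC :=
  \sum_(x | x != 0) phi (x + a / x).

Section QuadraticTower.
Variables (F L : finFieldType) (delta : F) (iota : {rmorphism F -> L}) (w : L).
Hypothesis F2 : 2%:R != 0 :> F.
Hypothesis nsq : nsqrt delta = 0%N.
Hypothesis w2 : w ^+ 2 = iota delta.
Hypothesis cardL : #|L| = (#|F| ^ 2)%N.

Let mk (z : F * F) : L := iota z.1 + iota z.2 * w.

Lemma quad_coord_bij : bijective mk.
Proof.
apply: inj_card_bij; last by rewrite card_prod cardL mulnn.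
move=> [x y] [x' y'] /eqP; rewrite /mk /=.
rewrite -subr_eq0 opprD addrACA -mulrBl -!rmorphB /= => /eqP h.
have [/eqP|yy] := eqVneq (y - y') 0.
  move: (h) => /[swap]; rewrite subr_eq0 => /eqP->.
  by rewrite subrr rmorph0 mul0r addr0 => /eqP; rewrite fmorph_eq0 subr_eq0 => /eqP->.
have wE : w = iota (- (x - x') / (y - y')).
  rewrite fmorph_div rmorphN /=; apply: (canRL (mulfK _)); rewrite ?fmorph_eq0 //.
  by apply/eqP; rewrite -addr_eq0 addrC mulrC h.
have /eqP : iota ((- (x - x') / (y - y')) ^+ 2) = iota delta.
  by rewrite rmorphXn /= -wE w2.
rewrite (inj_eq (fmorph_inj iota)) => dE.
by move: nsq => /eqP; rewrite cards_eq0 => /eqP/setP/(_ (- (x - x') / (y - y'))); rewrite !inE dE.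
Qed.

Let g : L -> F * F := fun z => odflt (0, 0) [pick xy | mk xy == z].

Let mkK xy : g (mk xy) = xy.
Proof.
rewrite /g; case: pickP => [z /eqP|/(_ xy)]; last by rewrite eqxx.
by move/(bij_inj quad_coord_bij).
Qed.

Let gK z : mk (g z) = z.
Proof. by have [h mkh hmk] := quad_coord_bij; rewrite -(hmk z) mkK. Qed.

Definition quad_trace (z : L) : F := 2%:R * (g z).1.
Local Notation T := quad_trace.

Let T_mk x y : T (iota x + iota y * w) = 2%:R * x.
Proof. by rewrite /T (mkK (x, y)). Qed.

Lemma quad_traceD : {morph T : x y / x + y}.
Proof.
move=> z z'; rewrite -[z]gK -[z']gK; case: (g z) (g z') => x y [x' y'].
rewrite /mk /= addrACA -mulrDl -!rmorphD /= !T_mk.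
by rewrite mulrDr.
Qed.

Lemma quad_traceZ b z : T (iota b * z) = b * T z.
Proof.
rewrite -[z]gK; case: (g z) => x y.
by rewrite /mk /= mulrDr mulrA -!rmorphM /= !T_mk mulrCA.
Qed.

Lemma quad_trace_Frob p r z :
  p \in [pchar F] -> T (z ^+ (p ^ r)) = T z ^+ (p ^ r).
Proof.
move=> charF; set n := (p ^ r)%N.
have p_pr := pcharf_prime charF.
have p2 : p != 2%N by apply: contraNneq F2 => <-; rewrite pcharf0.
have nat_n (R : comNzRingType) : p \in [pchar R] -> [pchar R].-nat n.
  by move=> cR; rewrite pnatX (eq_pnat _ (pcharf_eq cR)) pnat_id.
have charL : p \in [pchar L] by rewrite (fmorph_pchar iota).
have odd_n : odd n by rewrite oddX; case: (even_prime p_pr) p2 => [->|->]; rewrite ?orbT.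
have FD (x y : F) := exprDn_pchar x y (nat_n _ charF).
rewrite -[z]gK; case: (g z) => x y; rewrite /mk /= T_mk.
rewrite (exprDn_pchar _ _ (nat_n _ charL)) exprMn.
have -> : w ^+ n = iota (delta ^+ n./2) * w.
  by rewrite -[in LHS](odd_double_half n) odd_n addnC addn1 exprSr -muln2 mulnC exprM w2 rmorphXn.
rewrite mulrA -!rmorphXn -rmorphM /= T_mk exprMn; congr (_ * _).
by rewrite -[2%:R]/(1 + 1) FD expr1n.
Qed.

Lemma quad_trace_neq0 : exists z, T z != 0.
Proof.
exists (iota 1 + iota 0 * w); rewrite T_mk mulr1 //.
Qed.

Variables (e : addchar F) (a : F).
Hypothesis a0 : a != 0.
Local Notation q := (#|F|%:R : algC).

Let Phi (x D : F) : algC :=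
  if x ^+ 2 - D == 0 then 0 else e (2%:R * x * (1 + a / (x ^+ 2 - D))).

Lemma kloosterman_ext :
  kloosterman (e \o T) (iota a) = \sum_x \sum_y Phi x (delta * y ^+ 2).
Proof.
rewrite /kloosterman (reindex mk); last exact: onW_bij quad_coord_bij.
rewrite pair_bigA /= big_mkcond; apply: eq_bigr => -[x y] _ /=.
have N0 : (x ^+ 2 - delta * y ^+ 2 == 0) = (mk (x, y) == 0).
  transitivity ((x, y) == (0, 0)); last first.
    rewrite -(inj_eq (bij_inj quad_coord_bij)).
    by rewrite [mk (0, 0)]/mk /= !rmorph0 mul0r addr0.
  have [[-> ->]|xy] := eqVneq (x, y) (0, 0).
    by rewrite expr0n mulr0 subrr eqxx.
  apply/negbTE; apply: contra xy; rewrite subr_eq0 => /eqP xyE.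
  have [y0|y0] := eqVneq y 0.
    move: xyE; rewrite y0 expr0n mulr0 => /eqP; rewrite expf_eq0 /= => /eqP ->.
    by rewrite eqxx.
  have /eqP dE : (x / y) ^+ 2 = delta by rewrite expr_div_n xyE mulfK // expf_neq0.
  by move: nsq => /eqP; rewrite cards_eq0 => /eqP/setP/(_ (x / y)); rewrite !inE dE.
rewrite /Phi N0; case: eqVneq => //= mk0; congr (e _).
set N := _ - _ in N0 *.
have Nn0 : N != 0 by rewrite N0.
have mkN : mk (x, y) * (iota x - iota y * w) = iota N.
  by rewrite /mk /N /= rmorphB rmorphXn rmorphM rmorphXn /= -w2; ring.
have -> : iota a / mk (x, y) = iota (a / N) * (iota x - iota y * w).
  rewrite fmorph_div /= -mkN; field.
  rewrite mk0 andbT; move: Nn0; rewrite -(fmorph_eq0 iota) -mkN.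
  by rewrite mulf_eq0 negb_or => /andP[].
have -> : mk (x, y) + iota (a / N) * (iota x - iota y * w) =
    iota (x + a / N * x) + iota (y - a / N * y) * w.
  by rewrite /mk /= !(rmorphD, rmorphN, rmorphM) /=; ring.
by rewrite T_mk; ring.
Qed.

Lemma kloosterman_sqr :
  kloosterman e a ^+ 2 = \sum_x \sum_y Phi x (y ^+ 2).
Proof.
rewrite expr2 /kloosterman mulr_suml.
under eq_bigr do rewrite mulr_sumr.
rewrite pair_big /= (reindex _ (onW_bij _ (sum_diff_bij F2))) /=.
rewrite pair_bigA /= big_mkcond; apply: eq_bigr => -[x y] _ /=.
rewrite /Phi subr_sqr mulf_eq0 orbC -negb_or.
have [//|] := boolP (_ || _); rewrite negb_or => /andP[u0 v0] /=.
by rewrite -addcharD; congr (e _); field; rewrite u0 v0.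
Qed.

(** The element [x + y w] of [L] has trace [2 x] and norm [x ^ 2 - delta y ^ 2];
    the pair [x + y], [x - y] of elements of [F] has sum [2 x] and product
    [x ^ 2 - y ^ 2]. By [nonsquare_dichotomy] the values [delta y ^ 2] and
    [y ^ 2] together run twice through [F], so that the two sums together run
    twice over all pairs of a trace and a nonzero norm. *)
Lemma kloosterman_doubling :
  kloosterman (e \o T) (iota a) = 2%:R * q - kloosterman e a ^+ 2.
Proof.
apply/eqP; rewrite eq_sym subr_eq addrC; apply/eqP.
rewrite kloosterman_ext kloosterman_sqr -big_split /=.
transitivity (2%:R * \sum_x \sum_D Phi x D); last first.
  rewrite mulr_sumr; apply: eq_bigr => x _.
  have delta0 : delta != 0 by apply: contra_eq_neq nsq => ->; rewrite nsqrt0.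
  rewrite (sum_nsqrt (Phi x)) (sum_nsqrt (fun D => Phi x (delta * D))).
  rewrite [X in _ + X](reindex_inj (mulIf (invr_neq0 delta0))) /=.
  rewrite -big_split mulr_sumr /=; apply: eq_bigr => D _.
  rewrite mulrCA divff // mulr1 -mulrnDr nonsquare_dichotomy //.
  by rewrite mulr_natl.
congr (_ * _); under eq_bigr => x _ do
  rewrite (reindex_inj (subrI (x ^+ 2))) /=.
rewrite exchange_big (bigD1 0) //= [X in X + _]big1 ?add0r => [|x _]; last first.
  by rewrite /Phi subr0 subrr eqxx.
rewrite (bigD1 (- a)) ?oppr_eq0 //= [X in _ + X]big1 ?addr0 => [|n /andP[n0 na]].
  transitivity (\sum_(x : F) (1 : algC)); first by rewrite sumr_const.
  apply: eq_bigr => x _.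
  rewrite /Phi subKr oppr_eq0 (negPf a0) invrN mulrN divff // subrr mulr0.
  by rewrite addchar0.
have s0 : 2%:R * (1 + a / n) != 0.
  rewrite mulf_neq0 //; apply: contra na => /eqP h.
  by rewrite -addr_eq0 -(mulIr_eq0 _ (mulIf (invr_neq0 n0))) mulrDl divff // h.
transitivity (\sum_x e (x * (2%:R * (1 + a / n)))).
  apply: eq_bigr => x _; rewrite /Phi subKr (negPf n0).
  by congr (e _); ring.
by rewrite sum_addcharM (negPf s0) mulr0.
Qed.

End QuadraticTower.

(** * Points of the curve over the tower *)

Lemma kloosterman_ext_eq (K : finFieldType) (phi psi : K -> algC) a :
  phi =1 psi -> kloosterman phi a = kloosterman psi a.
Proof. by move=> h; apply: eq_bigr => x _; rewrite h. Qed.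

(** The value, after [j] quadratic extensions, of a Kloosterman sum equal to [x]
    over a field with [Q] elements. *)
Fixpoint doubled (Q : nat) (x : algC) (j : nat) : algC :=
  if j is j'.+1 then 2%:R * (Q ^ 2 ^ j')%:R - doubled Q x j' ^+ 2 else x.

Lemma doubledS Q x j :
  doubled Q x j.+1 = doubled (Q ^ 2) (2%:R * Q%:R - x ^+ 2) j.
Proof.
elim: j => [|j IH]; first by rewrite /= expn1.
by rewrite -[LHS]/(_ - doubled Q x j.+1 ^+ 2) IH /= -expnM -expnS.
Qed.

(** Here [T] is the trace from the top of the tower; only the properties listed
    are used. *)
Lemma tower_exists j (F : finFieldType) : 2%:R != 0 :> F ->
  exists (L : finFieldType) (iota : {rmorphism F -> L}) (T : L -> F),
  [/\ #|L| = (#|F| ^ 2 ^ j)%N,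
      [/\ {morph T : x y / x + y}, forall b z, T (iota b * z) = b * T z &
          exists z, T z != 0],
      forall p r z, p \in [pchar F] -> T (z ^+ (p ^ r)) = T z ^+ (p ^ r) &
      forall (e : addchar F) a, a != 0 ->
        kloosterman (e \o T) (iota a) = doubled #|F| (kloosterman e a) j].
Proof.
elim: j F => [|j IH] F F2.
  exists F, idfun, id; split=> //.
  by split=> //; exists 1; exact: oner_neq0.
have [delta nsq] := nonsquare_exists F2.
have [L1 [iota1 [w [w2 cardL1]]]] := quadratic_extension nsq.
have L12 : 2%:R != 0 :> L1 by rewrite -(rmorph_nat iota1) fmorph_eq0.
have [L [iota [T [cardL [TD TZ [z0 Tz0]] TF TK]]]] := IH L1 L12.
pose T1 := quad_trace iota1 w.
have T1D := quad_traceD nsq w2 cardL1 : {morph T1 : x y / x + y}.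
have T1Z := quad_traceZ nsq w2 cardL1 : forall b z, T1 (iota1 b * z) = b * T1 z.
have [z1 T1z1] := quad_trace_neq0 F2 nsq w2 cardL1; rewrite -/T1 in T1z1.
exists L, (iota \o iota1), (T1 \o T); split.
- by rewrite cardL cardL1 -expnM -expnS.
- split=> [x y|b z|] /=; first by rewrite TD T1D.
    by rewrite TZ T1Z.
  by exists (iota (z1 / T z0) * z0); rewrite TZ divfK.
- move=> p r z charF /=.
  rewrite TF ?(fmorph_pchar iota1) //.
  exact: (quad_trace_Frob F2 nsq w2 cardL1).
move=> e a a0.
have [b eb] := addchar_scale_neq1 e T1z1.
pose e1 : addchar L1 := @AddChar L1 (e \o T1)
  (fun x y => etrans (congr1 e (T1D x y)) (addcharD e _ _))
  (fun x => addchar_norm e _) (ex_intro _ (iota1 b * z1)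
     (etrans (congr1 (fun t => e t != 1) (T1Z b z1)) eb)).
have := TK e1 (iota1 a); rewrite fmorph_eq0 => /(_ a0).
rewrite doubledS cardL1 => ->; congr (doubled _ _ _).
exact: (kloosterman_doubling F2 nsq w2 cardL1 e a0).
Qed.

Lemma kloosterman_real (F : finFieldType) (e : addchar F) a :
  kloosterman e a \is Num.real.
Proof.
apply/CrealP; rewrite /kloosterman rmorph_sum (reindex_inj oppr_inj) /=.
apply: eq_big => [x|x _]; first by rewrite oppr_eq0.
by rewrite -addcharN invrN mulrN -opprD opprK.
Qed.

Section TraceFibre.
Variables (F L : finFieldType) (iota : {rmorphism F -> L}) (T : L -> F) (j : nat).
Local Notation q := #|F|.
Local Notation s := (q ^ 2 ^ j)%N.
Hypothesis F2 : 2%:R != 0 :> F.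
Hypothesis j_gt0 : (0 < j)%N.
Hypothesis cardL : #|L| = (q ^ 2 ^ j.+1)%N.
Hypothesis TD : {morph T : x y / x + y}.
Hypothesis TF :
  forall p r z, p \in [pchar F] -> T (z ^+ (p ^ r)) = T z ^+ (p ^ r).
Variable a : F.
Hypothesis a0 : a != 0.

Let TB x y : T (x - y) = T x - T y.
Proof. by apply: (addIr (T y)); rewrite -TD !subrK. Qed.

Let L2 : 2%:R != 0 :> L.
Proof. by rewrite -(rmorph_nat iota) fmorph_eq0. Qed.

Let c := iota a.
Let c0 : c != 0. Proof. by rewrite fmorph_eq0. Qed.

Lemma card_pchar_pow : exists p r, [/\ p \in [pchar F], q = (p ^ r)%N & (0 < r)%N].
Proof.
have [p p_pr charF] := finPcharP F.
have qE := card_pprimeChar charF; set r := logn p q in qE.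
exists p, r; split=> //; rewrite lt0n; apply/eqP => r0.
by have := finNzRing_gt1 F; rewrite qE r0.
Qed.

Lemma trace_artin_schreier w : T (w ^+ q - w) = 0.
Proof.
have [p [r [charF qE _]]] := card_pchar_pow.
by rewrite TB {1}qE TF // -qE expf_card subrr.
Qed.

Lemma artin_schreier_fibre t : (#|[set w : L | (w ^+ q - w)%R == t]| <= q)%N.
Proof.
have q_gt1 := finNzRing_gt1 F; pose P : {poly L} := 'X^q - ('X + t%:P).
have size_P : size P = q.+1.
  by rewrite size_polyDl size_polyXn // size_polyN size_XaddC.
rewrite -ltnS -size_P cardE; apply: max_poly_roots; last exact: enum_uniq.
  by rewrite -size_poly_gt0 size_P.
apply/allP => w; rewrite mem_enum inE /root !(hornerE, horner_exp) opprD addrA.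
by rewrite subr_eq0.
Qed.

Definition good_w := [set w : L | nsqrt ((w ^+ q - w) ^+ 2 - 4%:R * c)%R == 2%N].

(** For a nonsquare [delta], the remaining [w] are those counted by
    [stepanov_twist_count]. *)
Lemma card_good_w : (s ^ 2 + 1 <= 2 * #|good_w| + 4 * q * s)%N.
Proof.
have [p [r [charF qE r_gt0]]] := card_pchar_pow.
have charL : p \in [pchar L] by rewrite (fmorph_pchar iota).
have p_pr := pcharf_prime charF.
have p2 : p != 2%N by apply: contraNneq F2 => <-; rewrite pcharf0.
have odd_q : odd q by rewrite qE oddX; case: (even_prime p_pr) p2 => [->|->]; rewrite ?orbT.
have q_gt1 := finNzRing_gt1 F.
have q0 : q%:R = 0 :> L.
  by rewrite qE natrX pcharf0 // expr0n; case: r r_gt0 {qE}.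
have p_s : p.-nat s by rewrite qE !pnatX pnat_id.
have sE : s = (2 * s./2 + 1)%N.
  by rewrite mul2n addn1 -add1n -{1}[s]odd_double_half oddX odd_q orbT.
have cardL2 : #|L| = (s ^ 2)%N by rewrite cardL expnSr expnM.
have q_le_s : (q * q <= s)%N.
  by rewrite mulnn leq_exp2l // -{1}(expn1 2) leq_exp2l.
have q_ge3 : (2 < q)%N by rewrite ltn_neqAle q_gt1 andbT; apply: contraTneq odd_q => <-.
have [delta nsq] := nonsquare_exists L2.
have delta0 : delta != 0 by apply: contra_eq_neq nsq => ->; rewrite nsqrt0.
have c4 : 4%:R * c != 0 by rewrite mulf_neq0 ?four_neq0.
move: (p_s) (cardL2) (q_le_s); rewrite {1 2 3}sE => p_s' cardL' q_le_s'.
have := stepanov_twist_count charL p_s' cardL' q0 L2 q_ge3 q_le_s' c4 delta0.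
rewrite -!sE => twist.
have : (#|~: good_w| <= s./2 * (s + 1) + 2 * q * s)%N.
  apply: leq_trans twist; apply/subset_leq_card/subsetP => w.
  rewrite !inE => nD; set D := _ - _ in nD *.
  have /nsqrt_gt0[z Dz] : (0 < nsqrt (D / delta))%N.
    rewrite lt0n; apply: contra nD => /eqP D0.
    by have := nonsquare_dichotomy L2 D nsq; rewrite D0 addn0 => ->.
  by apply/existsP; exists z; rewrite -Dz mulrC divfK.
have := cardsC good_w; rewrite cardL2.
move: sE q_ge3; move: (#|good_w|) (#|~: good_w|) => x y.
by move: (s./2) s q; clear=> u s' q' sE; nia.
Qed.

(** Each good [w] gives two solutions [x] of [x + c / x = w ^ q - w], and the right
    side has trace zero; conversely [x] comes from at most [q] values of [w]. *)
Lemma card_trace_fibre :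
  (s ^ 2 + 1 <= q * #|[set x : L | ((x != 0) && (T (x + c / x) == 0))%R]| + 4 * q * s)%N.
Proof.
apply: leq_trans card_good_w _; rewrite leq_add2r.
set X := [set x | _].
pose R w x := (x != 0) && (w ^+ q - w == x + c / x).
apply: (@leq_trans (\sum_(w : L) \sum_(x : L | R w x) 1)%N).
  rewrite mulnC -sum_nat_const; rewrite big_mkcond /=; apply: leq_sum => w _.
  case: ifP => //; rewrite inE => /eqP <-; rewrite -(card_sum_roots L2 _ c0) sum1dep_card.
  by apply/subset_leq_card/subsetP => x; rewrite !inE /R => /andP[-> /eqP ->] /=.
rewrite (exchange_big_dep (mem X)) /= => [|w x _ /andP[x0 /eqP wx]]; last first.
  by rewrite inE x0 -wx trace_artin_schreier /=.
rewrite mulnC -sum_nat_const; apply: leq_sum => x _.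
rewrite sum1dep_card; apply: leq_trans (artin_schreier_fibre (x + c / x)).
by apply/subset_leq_card/subsetP => w; rewrite !inE => /andP[].
Qed.

End TraceFibre.

(** * The bound for Kloosterman sums *)

Definition addchar_scale (F : finFieldType) (e : addchar F) (b : F) (b0 : b != 0) :
  addchar F.
Proof.
exists (fun x => e (b * x)).
- by move=> x y; rewrite mulrDr addcharD.
- by move=> x; rewrite addchar_norm.
by have [x ex] := addchar_scale_neq1 e b0; exists x; rewrite mulrC.
Defined.

Section KloostermanBound.
Variables (F : finFieldType) (e : addchar F) (a : F).
Hypothesis F2 : 2%:R != 0 :> F.
Hypothesis a0 : a != 0.
Local Notation q := #|F|.

Lemma doubled_real x j : x \is Num.real -> doubled q x j \is Num.real.
Proof.
move=> xR; elim: j => [|j IH] //=.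
by rewrite rpredB ?rpredX // rpredM ?realn.
Qed.

Lemma doubled_le x j : x \is Num.real -> doubled q x j.+1 <= 2%:R * (q ^ 2 ^ j)%:R.
Proof. by move=> xR; rewrite gerBl real_exprn_even_ge0 ?doubled_real. Qed.

(** With [X] the sum and [Q] the size of the field at some stage, the quantity
    [X ^ 2 - 4 Q] is multiplied by [X ^ 2 >= 4 Q] at the next stage, whereas the
    size of the field is multiplied by [Q]. *)
Lemma doubled_growth x j : x \is Num.real -> 4%:R * q%:R <= x ^+ 2 ->
  (4 ^ j * q ^ 2 ^ j)%:R * (x ^+ 2 - 4%:R * q%:R)
    <= q%:R * (doubled q x j ^+ 2 - 4%:R * (q ^ 2 ^ j)%:R).
Proof.
move=> xR x_ge; set D0 := x ^+ 2 - _; have D0_ge0 : 0 <= D0 by rewrite subr_ge0.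
elim: j => [|j IH]; first by rewrite mul1n expn0 expn1.
set X := doubled q x j in IH *; set Q := (q ^ 2 ^ j)%N in IH *.
have QE : (q ^ 2 ^ j.+1 = Q ^ 2)%N by rewrite expnSr expnM.
have -> : doubled q x j.+1 = 2%:R * Q%:R - X ^+ 2 by [].
have q_gt0 : 0 < q%:R :> algC by rewrite ltr0n (ltnW (finNzRing_gt1 F)).
have D_ge0 : 0 <= q%:R * (X ^+ 2 - 4%:R * Q%:R).
  by apply: le_trans IH; rewrite mulr_ge0 ?ler0n.
have X2 : 4%:R * Q%:R <= X ^+ 2 by rewrite -subr_ge0 -(pmulr_rge0 _ q_gt0).
have -> : q%:R * ((2%:R * Q%:R - X ^+ 2) ^+ 2 - 4%:R * (q ^ 2 ^ j.+1)%:R) =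
    X ^+ 2 * (q%:R * (X ^+ 2 - 4%:R * Q%:R)) :> algC.
  by rewrite QE natrX; ring.
apply: le_trans (ler_wpM2r D_ge0 X2).
have -> : (4 ^ j.+1 * q ^ 2 ^ j.+1)%:R * D0 = 4%:R * Q%:R * ((4 ^ j * Q)%:R * D0).
  by rewrite QE expnS !(natrM, natrX); ring.
by rewrite ler_wpM2l // -natrM ler0n.
Qed.

(** At the next stage the sum is [2 s - X ^ 2], with [s] the size of the field at
    stage [j]. Its twists by nonzero elements of [F] are all at most [2 s], while
    their total is at least [- 4 q s] by [card_trace_fibre]; so none of them can
    be very negative. *)
Lemma doubled_upper j : (0 < j)%N ->
  doubled q (kloosterman e a) j ^+ 2 <= 6%:R * q%:R * (q ^ 2 ^ j)%:R.
Proof.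
move=> j_gt0; have [L [iota [T [cardL [TD TZ _] TF TK]]]] := tower_exists j.+1 F2.
have := card_trace_fibre iota F2 j_gt0 cardL TD TF a0.
set X := [set x | _]; set s := (q ^ 2 ^ j)%N => fibre.
pose K b := kloosterman (fun x => e (b * T x)) (iota a).
(* Summing over all twists detects the elements of trace zero. *)
have sumK : \sum_b K b = q%:R * #|X|%:R.
  rewrite /K /kloosterman exchange_big /=.
  under eq_bigr do rewrite sum_addcharM.
  rewrite -mulr_sumr; congr (_ * _).
  rewrite -sum1_card natr_sum [RHS]big_mkcond [LHS]big_mkcond /=.
  by apply: eq_bigr => x _; rewrite inE; case: (x != 0) => //=; case: (_ == _).
have K0 : K 0 = s%:R ^+ 2 - 1.
  rewrite /K /kloosterman.
  under eq_bigr do rewrite mul0r addchar0.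
  rewrite sumr_const cardC1 cardL expnSr expnM -natrX.
  have : (0 < s ^ 2)%N by rewrite !expn_gt0 (ltnW (finNzRing_gt1 F)).
  by rewrite -/s; case: (s ^ 2)%N => // n _; rewrite -natr1 addrK.
have Kb b : b != 0 -> K b <= 2%:R * s%:R.
  move=> b0; rewrite -[K b]/(kloosterman (addchar_scale e b0 \o T) (iota a)).
  by rewrite TK // doubled_le ?kloosterman_real.
have K1 : K 1 = 2%:R * s%:R - doubled q (kloosterman e a) j ^+ 2.
  rewrite -[RHS]/(doubled q _ j.+1) -TK //.
  by apply: kloosterman_ext_eq => x; rewrite mul1r.
have low : - (4%:R * q%:R * s%:R) <= \sum_(b | b != 0) K b.
  have -> : \sum_(b | b != 0) K b = \sum_b K b - K 0.
    by rewrite [in RHS](bigD1 0) //= addrC addrK.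
  rewrite sumK K0 lerNl opprB lerBlDr; move: fibre.
  rewrite -(ler_nat algC) !(natrD, natrM, natrX) => fibre.
  apply: le_trans (le_trans _ fibre) _; first by rewrite lerD2l (le_trans (lerN10 _) ler01).
  by rewrite addrC.
have up : \sum_(b | b != 0) K b <=
    2%:R * q%:R * s%:R - doubled q (kloosterman e a) j ^+ 2.
  rewrite (bigD1 1) ?oner_neq0 //= K1.
  have le_b : \sum_(b | (b != 0) && (b != 1)) K b <= \sum_(b : F | (b != 0) && (b != 1)) (2%:R * s%:R : algC).
    by apply: ler_sum => b /andP[b0 _]; exact: Kb.
  move: le_b; rewrite sumr_const => le_sum; rewrite addrAC lerD2r.
  apply: le_trans (lerD (lexx _) le_sum) _; rewrite -mulrS -[leLHS]mulr_natr.
  rewrite [leRHS]mulrAC ler_wpM2l // -?natrM ?ler0n // ler_nat.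
  apply: (@leq_trans #|[pred b : F | b != 0]|); last exact: max_card.
  rewrite [X in (_ <= X)%N](cardD1 1) !inE oner_neq0 add1n ltnS.
  by apply/subset_leq_card/subsetP => b; rewrite !inE andbC.
have := le_trans low up; rewrite lerBrDr addrC lerBlDr => /le_trans; apply.
by rewrite -!mulrDl -natrD.
Qed.

(** If the bound failed, [doubled_growth] would make the sum at stage [j] larger
    than [doubled_upper] allows, by a factor of order [4 ^ j]. *)
Lemma kloosterman_bound : `|kloosterman e a| ^+ 2 <= 4%:R * q%:R.
Proof.
have KR := kloosterman_real e a.
rewrite real_normK // real_leNgt ?rpredX ?rpredM ?realn //; apply/negP => big.
set x := kloosterman e a in KR big.
have D0_gt0 : 0 < x ^+ 2 - 4%:R * q%:R by rewrite subr_gt0.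
set D0 := _ - _ in D0_gt0.
have B_ge0 : 0 <= 6%:R * q%:R * q%:R / D0 :> algC.
  by rewrite divr_ge0 ?(ltW D0_gt0) // -!natrM ler0n.
have [n B_n] : exists n, 6%:R * q%:R * q%:R / D0 < n%:R :> algC.
  by exists (Num.bound (6%:R * q%:R * q%:R / D0 : algC)); apply: archi_boundP.
have Q_gt0 : 0 < (q ^ 2 ^ n.+1)%:R :> algC.
  by rewrite ltr0n expn_gt0 (ltnW (finNzRing_gt1 F)).
have : (4 ^ n.+1)%:R * D0 <= 6%:R * q%:R * q%:R.
  rewrite -(ler_pM2r Q_gt0) mulrAC -[X in X * D0]natrM.
  apply: le_trans (doubled_growth n.+1 KR (ltW big)) _; rewrite -/x.
  apply: (@le_trans _ _ (q%:R * doubled q x n.+1 ^+ 2)).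
    by rewrite ler_wpM2l ?ler0n // gerBl -natrM ler0n.
  apply: le_trans (ler_wpM2l _ (doubled_upper (ltn0Sn n))) _; first exact: ler0n.
  by rewrite le_eqVlt; apply/orP; left; apply/eqP; ring.
rewrite -ler_pdivlMr // => /le_lt_trans/(_ B_n); rewrite ltr_nat.
by rewrite ltnNge ltnW // ltnW // ltn_expl.
Qed.

End KloostermanBound.

(** * Gauss, Salie and twisted sums *)

Section Gauss.
Variables (F : finFieldType) (e : addchar F).
Hypothesis F2 : 2%:R != 0 :> F.
Local Notation q := #|F|.

(** Encoded by the number of square roots, the form in which it enters counts. *)
Definition quadchar (x : F) : algC := (nsqrt x)%:R - 1.
Local Notation eta := quadchar.

Lemma quadchar0 : eta 0 = 0.
Proof. by rewrite /quadchar nsqrt0 subrr. Qed.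

Lemma quadchar_sqr y : y != 0 -> eta (y ^+ 2) = 1.
Proof. by move=> y0; rewrite /quadchar nsqrt_sqr // (natrD _ 1 1) addrK. Qed.

Lemma quadcharM x y : eta (x * y) = eta x * eta y.
Proof.
have [->|x0] := eqVneq x 0; first by rewrite mul0r quadchar0 mul0r.
have [/eqP nsq|/nsqrt_gt0[z xE]] := posnP (nsqrt x).
  have := nonsquare_dichotomy F2 (x * y) (eqP nsq).
  rewrite mulrAC divff // mul1r /quadchar (eqP nsq) sub0r mulN1r opprB.
  move/(congr1 (fun m => m%:R : algC)); rewrite natrD => /(canRL (addrK _)) ->.
  by ring.
rewrite xE quadchar_sqr; last by rewrite -sqrf_eq0 -xE.
have z0 : z != 0 by rewrite -sqrf_eq0 -xE.
rewrite mul1r /quadchar; congr (_%:R - 1).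
rewrite /nsqrt -[RHS](card_imset _ (mulfI z0)); apply: eq_card => w.
rewrite inE; apply/eqP/imsetP => [wE|[u]].
  by exists (w / z); rewrite ?inE ?expr_div_n ?wE ?[z * _]mulrC ?divfK // mulrC mulKf // expf_neq0.
by rewrite inE => /eqP uE ->; rewrite exprMn uE.
Qed.

Lemma quadchar2 x : x != 0 -> eta x ^+ 2 = 1.
Proof. by move=> x0; rewrite expr2 -quadcharM -expr2 quadchar_sqr. Qed.

Lemma quadchar_norm x : x != 0 -> `|eta x| = 1.
Proof.
move=> x0; apply/eqP; rewrite -(@sqrp_eq1 _ `|eta x|) // -normrX quadchar2 //.
by rewrite normr1.
Qed.

Definition gauss (s : F) : algC := \sum_x e (s * x ^+ 2).

Lemma gaussE s : s != 0 -> gauss s = \sum_x eta x * e (s * x).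
Proof.
move=> s0; rewrite /gauss (sum_nsqrt (fun x => e (s * x))).
transitivity (\sum_x eta x * e (s * x) + \sum_x e (x * s)).
  by rewrite -big_split; apply: eq_bigr => x _ /=; rewrite -mulr_natl [x * s]mulrC /quadchar; ring.
by rewrite sum_addcharM (negPf s0) mulr0 addr0.
Qed.

Lemma gauss_norm s : s != 0 -> `|gauss s| ^+ 2 = q%:R.
Proof.
move=> s0; rewrite normCK /gauss rmorph_sum mulr_suml.
under eq_bigr do rewrite mulr_sumr.
rewrite pair_big /= (reindex _ (onW_bij _ (sum_diff_bij F2))) /=.
transitivity (\sum_(u : F) \sum_(v : F) e (v * (4%:R * s * u))).
  rewrite pair_big /=; apply: eq_bigr => -[u v] _ /=.
  by rewrite -addcharN -addcharD; congr (e _); ring.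
under eq_bigr do rewrite sum_addcharM.
rewrite (bigD1 0) //= mulr0 eqxx mulr1 big1 ?addr0 // => u u0.
by rewrite !mulf_eq0 (negPf (four_neq0 F2)) (negPf s0) (negPf u0) mulr0.
Qed.

Lemma gauss_quadchar s : s != 0 -> gauss s = eta s * gauss 1.
Proof.
move=> s0; rewrite !gaussE ?oner_neq0 // (reindex_inj (mulfI (invr_neq0 s0))) mulr_sumr.
apply: eq_bigr => x _; rewrite mulVKf // mul1r mulrA -quadcharM.
have -> : s^-1 * x = s * x * s^-1 ^+ 2 by field.
by rewrite [in LHS]quadcharM quadchar_sqr ?invr_eq0 // mulr1.
Qed.

Definition salie (a : F) : algC := \sum_(x | x != 0) eta x * e (x + a / x).

(** If [a] is not a square, then [x |-> a / x] shows that the sum is its own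
    opposite. If [a = c ^ 2], then [x + a / x] differs from [2 c] and from [- 2 c]
    by a square times [x], so that summing over [x] with [x + a / x] fixed leaves
    two shifted Gauss sums. *)
Lemma salie_norm a : a != 0 -> `|salie a| ^+ 2 <= 4%:R * q%:R.
Proof.
move=> a0; have [nsq|/nsqrt_gt0[c aE]] := posnP (nsqrt a).
  suff : salie a = - salie a.
    move/eqP; rewrite -addr_eq0 -mulr2n mulrn_eq0 /= => /eqP->.
    by rewrite normr0 expr0n -natrM ler0n.
  rewrite -mulN1r /salie mulr_sumr.
  have h_inj : injective (fun x => a / x) by move=> x y /(mulfI a0)/invr_inj.
  rewrite (reindex_inj h_inj) /=; apply: eq_big => [x|x].
    by rewrite mulf_eq0 invr_eq0 (negPf a0).
  rewrite mulf_eq0 invr_eq0 (negPf a0) /= => x0.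
  have -> : a / x = a * (x * x^-1 ^+ 2) by field.
  rewrite (quadcharM a) (quadcharM x) quadchar_sqr ?invr_neq0 // mulr1 [eta a]/quadchar nsq sub0r.
  by rewrite -mulrA; congr (_ * (_ * e _)); field; rewrite x0 a0.
have c0 : c != 0 by rewrite -sqrf_eq0 -aE.
have inner t : \sum_(x | (x != 0) && (x + a / x == t)) eta x =
    eta (t - 2%:R * c) + eta (t + 2%:R * c).
  have [->|tc] := eqVneq t (2%:R * c).
    rewrite subrr quadchar0 add0r -mulrDl -natrD.
    rewrite (_ : 4%:R * c = c * 2%:R ^+ 2); last by ring.
    rewrite quadcharM quadchar_sqr // mulr1 (big_pred1 c) // => x /=.
    apply/andP/eqP => [[x0 /eqP h]|->]; last by split=> //; rewrite aE; apply/eqP; field.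
    apply/eqP; rewrite -subr_eq0 -sqrf_eq0; apply/eqP.
    have -> : (x - c) ^+ 2 = x * (x + a / x) - 2%:R * c * x by rewrite aE; field.
    by rewrite h; ring.
  rewrite (eq_bigr (fun=> eta (t - 2%:R * c))) => [|x /andP[x0 /eqP h]]; last first.
    have tE : t - 2%:R * c = x * ((x - c) / x) ^+ 2 by rewrite -h aE; field.
    rewrite tE quadcharM quadchar_sqr ?mulr1 // mulf_neq0 ?invr_neq0 //.
    rewrite subr_eq0; apply: contra_neq tc => xc; rewrite -h aE xc; field.
    by rewrite -xc.
  rewrite sumr_const; set m := #|_|.
  have -> : m = nsqrt (t ^+ 2 - 4%:R * a).
    by rewrite -card_sum_roots // /m; apply: eq_card => x; rewrite inE.
  have -> : t ^+ 2 - 4%:R * a = (t - 2%:R * c) * (t + 2%:R * c) by rewrite aE; ring.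
  rewrite -[LHS]mulr_natr.
  have -> D : (nsqrt D)%:R = eta D + 1 by rewrite /quadchar subrK.
  rewrite quadcharM mulrDr mulr1 mulrA -expr2 quadchar2 ?subr_eq0 // mul1r.
  by rewrite addrC.
have gauss_shift u : \sum_t eta (t + u) * e t = e (- u) * gauss 1.
  rewrite gaussE ?oner_neq0 // mulr_sumr (reindex_inj (addIr (- u))) /=.
  apply: eq_bigr => t _; rewrite subrK mul1r addrC addcharD.
  by rewrite mulrCA.
have -> : salie a = (e (2%:R * c) + e (- (2%:R * c))) * gauss 1.
  rewrite /salie (partition_big (fun x => x + a / x) xpredT) //=.
  rewrite mulrDl -{1}[2%:R * c]opprK -!gauss_shift -big_split /=.
  apply: eq_bigr => t _; rewrite -mulrDl -inner mulr_suml.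
  by apply: eq_bigr => x /andP[_ /eqP->].
rewrite normrM exprMn gauss_norm ?oner_neq0 // ler_wpM2r ?ler0n //.
rewrite (_ : 4%:R = 2%:R ^+ 2 :> algC); last by rewrite -natrX.
rewrite ler_sqr ?nnegrE ?ler0n //; apply: le_trans (ler_normD _ _) _.
by rewrite !addchar_norm.
Qed.

Definition gaussn n (s : F) : algC := \sum_(y : 'rV_n) e (s * dot y y).

Lemma gaussn_exp n s : gaussn n s = gauss s ^+ n.
Proof.
rewrite /gauss -[n in RHS]card_ord -prodr_const bigA_distr_bigA /gaussn /=.
pose h (f : {ffun 'I_n -> F}) : 'rV[F]_n := \row_i f i.
have h_bij : bijective h.
  exists (fun y : 'rV_n => [ffun i => y 0 i]) => f.
    by apply/ffunP => i; rewrite ffunE mxE.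
  by apply/rowP => i; rewrite mxE ffunE.
rewrite (reindex h) /=; last exact: onW_bij h_bij.
apply: eq_bigr => f _; rewrite -addchar_sum mulr_sumr; congr (e _).
by apply: eq_bigr => i _; rewrite !mxE.
Qed.

Lemma sum_quadratic n s (b : 'rV_n) : s != 0 ->
  \sum_y e (s * dot y y + dot b y) = gaussn n s * e (- (dot b b / (4%:R * s))).
Proof.
move=> s0; rewrite /gaussn mulr_suml.
rewrite (reindex_inj (addIr (- (2%:R * s)^-1 *: b))) /=.
apply: eq_bigr => y _; rewrite -addcharD; congr (e _).
by rewrite !dot_linear [dot b y]dotC; field; rewrite s0 F2 four_neq0.
Qed.

(** Up to a constant of absolute value [q ^ (n / 2)], this is a Kloosterman sum
    for even [n] and a Salie sum for odd [n]. *)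
Definition twisted_sum n (a b : F) : algC :=
  \sum_(s | s != 0) gaussn n s * e (- (a * s) - b / s).

Lemma twisted_sumE n a b : twisted_sum n a b =
  gauss 1 ^+ n * \sum_(s | s != 0) eta s ^+ n * e (- (a * s) - b / s).
Proof.
rewrite mulr_sumr; apply: eq_bigr => s s0.
by rewrite gaussn_exp gauss_quadchar // exprMn; ring.
Qed.

Lemma twisted_sum_norm_triv n a b :
  `|twisted_sum n a b| ^+ 2 <= q%:R ^+ n.+2.
Proof.
rewrite twisted_sumE normrM normrX exprMn -exprM mulnC exprM gauss_norm ?oner_neq0 //.
rewrite -[n.+2]addn2 [leRHS]exprD ler_wpM2l ?exprn_ge0 ?ler0n //.
rewrite ler_sqr ?nnegrE ?ler0n //; apply: le_trans (ler_norm_sum _ _ _) _.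
rewrite (eq_bigr (fun=> 1)) => [|s s0]; last first.
  by rewrite normrM normrX quadchar_norm // expr1n mul1r addchar_norm.
by rewrite sumr_const ler_nat max_card.
Qed.

Lemma twisted_sum_norm n a b : a != 0 ->
  `|twisted_sum n a b| ^+ 2 <= 4%:R * q%:R ^+ n.+1.
Proof.
move=> a0.
rewrite twisted_sumE normrM normrX exprMn -exprM mulnC exprM gauss_norm ?oner_neq0 //.
rewrite [_ ^+ n.+1]exprSr [leRHS]mulrCA ler_wpM2l ?exprn_ge0 ?ler0n //.
have etaX s : s != 0 -> eta s ^+ n = if odd n then eta s else 1.
  move=> s0; rewrite -[n in LHS]odd_double_half exprD -muln2 mulnC exprM.
  by rewrite quadchar2 // expr1n mulr1; case: (odd n).
rewrite (eq_bigr (fun s => (if odd n then eta s else 1) * e (- (a * s) - b / s)));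
  last by move=> s s0; rewrite etaX.
have ma0 : - a != 0 by rewrite oppr_eq0.
have [->|b0] := eqVneq b 0.
  under eq_bigr do rewrite mul0r subr0 -mulNr.
  case: (odd n).
    rewrite -[X in `|X| ^+ 2](_ : gauss (- a) = _).
      by rewrite gauss_norm // ler_peMl ?ler0n // ler1n.
    rewrite gaussE // (bigD1 0) //= quadchar0 mul0r add0r.
    by [].
  under eq_bigr do rewrite mul1r mulrC.
  rewrite sum_addchar_neq0 (negPf ma0) mulr0 sub0r normrN1 expr1n.
  by rewrite -natrM ler1n muln_gt0 /= (ltnW (finNzRing_gt1 F)).
have ab0 : a * b != 0 by rewrite mulf_neq0.
have ia_inj : injective (fun x => - (a^-1 * x)).
  by move=> x y /oppr_inj/(mulfI (invr_neq0 a0)).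
rewrite (reindex_inj ia_inj) /=.
have cond x : (- (a^-1 * x) != 0) = (x != 0).
  by rewrite oppr_eq0 mulf_eq0 invr_eq0 (negPf a0).
have arg x : x != 0 -> - (a * (- (a^-1 * x))) - b / (- (a^-1 * x)) = x + a * b / x.
  by move=> x0; field; rewrite oppr_eq0 x0 a0.
case: (odd n).
  have -> : \sum_(j | - (a^-1 * j) != 0)
      eta (- (a^-1 * j)) * e (- (a * - (a^-1 * j)) - b / - (a^-1 * j)) =
      eta (- a^-1) * salie (a * b).
    rewrite mulr_sumr; apply: eq_big => // x; rewrite cond => x0.
    by rewrite arg // -mulNr quadcharM mulrA.
  by rewrite normrM quadchar_norm ?oppr_eq0 ?invr_eq0 // mul1r salie_norm.
have -> : \sum_(j | - (a^-1 * j) != 0)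
    1 * e (- (a * - (a^-1 * j)) - b / - (a^-1 * j)) = kloosterman e (a * b).
  by apply: eq_big => // x; rewrite cond => x0; rewrite arg // mul1r.
exact: kloosterman_bound.
Qed.

End Gauss.

(** * Zeros of quadratic functions on affine spaces *)

Section AffineCounting.
Variables (F : finFieldType) (d : nat).
Hypothesis F2 : 2%:R != 0 :> F.
Local Notation q := #|F|.

Lemma card_odd_field : (2 < q)%N.
Proof.
rewrite ltn_neqAle (finNzRing_gt1 F) andbT; apply: contraNneq F2 => q2.
by have := @card_finPcharP F 2 1 (esym q2) isT; rewrite inE => /andP[].
Qed.

Lemma row_free_col_mx n (y : 'rV[F]_d) (Y : 'M_(n, d)) :
  row_free (col_mx y Y) = row_free Y && ~~ (y <= Y)%MS.
Proof.
apply/idP/andP => [free_yY | [free_Y yY]].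
  have inj := @row_free_inj _ 1 _ _ _ free_yY; split.
    apply: inj_row_free => c cY; have : row_mx 0 c = 0 :> 'M_(1, 1 + n).
      by apply: inj; rewrite mul_row_col cY !mul0mx addr0.
    by move/(congr1 rsubmx); rewrite row_mxKr linear0.
  apply/negP => /submxP[c yE]; have : row_mx 1%:M (- c) = 0 :> 'M_(1, 1 + n).
    by apply: inj; rewrite mul_row_col mul1mx mulNmx -yE subrr mul0mx.
  by move/(congr1 lsubmx)/matrixP/(_ 0 0)/eqP; rewrite row_mxKl linear0 !mxE oner_eq0.
apply: inj_row_free => c; rewrite -[c]hsubmxK mul_row_col.
set c0 := lsubmx c; set c1 := rsubmx c => eq0.
have c00 : c0 = 0.
  apply: contraNeq yY => c00.
  have c0E : c0 = (c0 0 0)%:M by rewrite -mx11_scalar.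
  have nz : c0 0 0 != 0 by apply: contraNneq c00 => z; rewrite c0E z raddf0.
  move/eqP: eq0; rewrite addr_eq0 c0E mul_scalar_mx => /eqP yE.
  rewrite -[y](scalerK nz) yE; apply: scalemx_sub; rewrite -mulNmx; exact: submxMl.
rewrite c00 mul0mx add0r in eq0 *.
have -> : c1 = 0 by apply: (row_free_inj free_Y); rewrite eq0 mul0mx.
exact: row_mx0.
Qed.

Lemma sum_col_mx (R : nmodType) n (P : pred 'M[F]_(1 + n, d)) (f : 'M_(1 + n, d) -> R) :
  \sum_(X | P X) f X =
  \sum_(Y : 'M_(n, d)) \sum_(y : 'rV_d | P (col_mx y Y)) f (col_mx y Y).
Proof.
rewrite pair_big_dep /=; pose h (z : 'M[F]_(n, d) * 'rV[F]_d) := col_mx z.2 z.1.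
rewrite (reindex h) /=; first by apply: eq_bigl => -[Y y].
exists (fun X : 'M[F]_(1 + n, d) => (dsubmx X, usubmx X)) => [[Y y] _|X _]; rewrite /h /=.
  by rewrite col_mxKu col_mxKd.
by rewrite vsubmxK.
Qed.

Lemma card_col_mx n (P : pred 'M[F]_(1 + n, d)) :
  #|[set X | P X]| =
  (\sum_(Y : 'M_(n, d)) #|[set y : 'rV_d | P (col_mx y Y)]|)%N.
Proof.
rewrite -sum1dep_card (sum_col_mx P (fun=> 1%N)).
by apply: eq_bigr => Y _; rewrite sum1dep_card.
Qed.

(** The row space of 'Z' is its own double orthogonal complement. *)
Lemma sub_perp_kermx z m (Z : 'M[F]_(z, d)) (X : 'M_(m, d)) :
  row_free Z -> X *m (kermx Z^T)^T = 0 -> (X <= Z)%MS.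
Proof.
move=> free_Z XK; set K := kermx Z^T in XK.
have KZ : K *m Z^T = 0 by apply/eqP; rewrite -sub_kermx.
have rK : \rank K = (d - z)%N by rewrite mxrank_ker mxrank_tr (eqP free_Z).
have XK' : (X <= kermx K^T)%MS by apply/sub_kermxP.
apply: submx_trans XK' _.
have ZK : (Z <= kermx K^T)%MS.
  by apply/sub_kermxP; rewrite -[Z]trmxK -trmx_mul KZ trmx0.
rewrite -(geq_leqif (mxrank_leqif_sup ZK)) mxrank_ker mxrank_tr rK (eqP free_Z).
by rewrite subKn // -(eqP free_Z) rank_leq_col.
Qed.

(** A form vanishing on the diagonal vanishes, the characteristic being odd. *)
Lemma isotropic_kermx z (Z : 'M[F]_(z, d)) :
    (forall w : 'rV_d, w *m Z^T = 0 -> dot w w = 0) ->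
  kermx Z^T *m (kermx Z^T)^T = 0.
Proof.
move=> iso; set K := kermx Z^T; apply/matrixP => i j; rewrite [RHS]mxE.
have -> : (K *m K^T) i j = dot (row i K) (row j K).
  by rewrite -mulmx_dot -row_mul [RHS]mxE.
have rowK l : row l K *m Z^T = 0 by rewrite -row_mul mulmx_ker row0.
have := iso (row i K + row j K); rewrite mulmxDl !rowK addr0 => /(_ erefl).
rewrite !dot_linear !iso ?rowK // [dot (row j K) _]dotC add0r addr0 -mulr2n.
by move/eqP; rewrite -mulr_natl mulf_eq0 (negPf F2) => /eqP.
Qed.

Definition affine z (Z : 'M[F]_(z, d)) (tau : 'rV_z) : {set 'rV_d} :=
  [set y | y *m Z^T == tau].

Lemma affine_exists z (Z : 'M_(z, d)) tau : row_free Z -> exists y, y \in affine Z tau.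
Proof.
move=> free_Z; exists (tau *m pinvmx Z^T); rewrite inE mulmxKpV //.
by rewrite submx_full // /row_full mxrank_tr.
Qed.

Lemma card_affine0 z (Z : 'M_(z, d)) : #|affine Z 0| = (q ^ (d - \rank Z))%N.
Proof.
rewrite -[\rank Z]mxrank_tr -mxrank_ker -card_rowg; apply: eq_card => y.
by rewrite mem_rowg inE; apply/eqP/sub_kermxP.
Qed.

Lemma mem_affineD z (Z : 'M_(z, d)) tau y w :
  y \in affine Z tau -> (y + w \in affine Z tau) = (w \in affine Z 0).
Proof. by rewrite !inE => /eqP yE; rewrite mulmxDl yE -subr_eq0 addrAC subrr add0r. Qed.

Lemma card_affine_nonempty z (Z : 'M_(z, d)) tau y :
  y \in affine Z tau -> #|affine Z tau| = #|affine Z 0|.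
Proof.
move=> yE; rewrite -[RHS](card_imset _ (addrI y)); apply: eq_card => x.
apply/idP/imsetP => [xE|[w wE ->]]; last by rewrite mem_affineD.
by exists (x - y); [rewrite -(mem_affineD _ yE) addrC subrK|rewrite addrC subrK].
Qed.

Lemma card_affine z (Z : 'M_(z, d)) tau : row_free Z ->
  #|affine Z tau| = (q ^ (d - z))%N.
Proof.
move=> free_Z; have [y yE] := affine_exists tau free_Z.
by rewrite (card_affine_nonempty yE) card_affine0 (eqP free_Z).
Qed.

(** The lines through a point where a quadratic function does not vanish cover the
    space, and each of them meets the zero set at most twice. *)
Lemma card_quadratic_zeros z (Z : 'M_(z, d)) tau psi y0 :
    y0 \in affine Z tau -> psi y0 != 0 :> F ->
    (forall u, u \in affine Z 0 -> exists b c, forall l,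
       psi (y0 + l *: u) = psi y0 + b * l + c * l ^+ 2) ->
  (q * #|[set y in affine Z tau | psi y == 0%R]| <= 3 * #|affine Z 0|)%N.
Proof.
move=> y0E psi0 quad; set N := #|_|.
suff : ((q - 1) * N <= 2 * #|affine Z 0|)%N by have := card_odd_field; nia.
have line l : l != 0 -> N = #|[set u in affine Z 0 | psi (y0 + l *: u) == 0]|.
  move=> l0; have h_inj : injective (fun u => y0 + l *: u).
    by move=> u u' /addrI/(scalerI l0).
  rewrite -[RHS](card_imset _ h_inj); apply: eq_card => y.
  rewrite inE; apply/andP/imsetP => [[yE psiy]|[u]].
    have yy : y0 + l *: (l^-1 *: (y - y0)) = y.
      by rewrite scalerA divff // scale1r addrC subrK.
    exists (l^-1 *: (y - y0)) => //; rewrite inE yy psiy andbT.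
    rewrite inE -scalemxAl scaler_eq0 invr_eq0 (negPf l0) /= mulmxBl subr_eq0.
    by move: yE y0E; rewrite !inE => /eqP-> /eqP->.
  rewrite inE => /andP[uE psiu] ->; split=> //.
  rewrite mem_affineD // inE -scalemxAl.
  by move: uE; rewrite inE => /eqP->; rewrite scaler0.
have -> : ((q - 1) * N = \sum_(l | l != 0%R :> F) N)%N.
  by rewrite sum_nat_const cardC1 subn1.
under eq_bigr => l l0 do rewrite (line l l0) -sum1dep_card.
rewrite (exchange_big_dep (mem (affine Z 0))) /= => [|l u _ /andP[]//].
rewrite mulnC -sum_nat_const; apply: leq_sum => u uE.
have [b [c psiE]] := quad u uE.
pose p : {poly F} := c *: 'X^2 + (b *: 'X + (psi y0)%:P).
have p0 : p != 0.
  have p_0 : p.[0] = psi y0 by rewrite !(hornerE, horner_exp) /=; ring.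
  by apply: contraNneq psi0 => p0; rewrite -p_0 p0 horner0.
have size_p : (size p <= 3)%N.
  rewrite (leq_trans (size_polyD _ _)) // geq_max.
  rewrite (leq_trans (size_scale_leq _ _)) ?size_polyXn //.
  rewrite (leq_trans (size_polyD _ _)) // geq_max size_polyC.
  rewrite (leq_trans (size_scale_leq _ _)) ?size_polyX //.
  by case: (_ != 0).
rewrite sum1dep_card -ltnS; apply: leq_trans size_p; rewrite cardE.
apply: max_poly_roots => //; last exact: enum_uniq.
apply/allP => l; rewrite mem_enum !inE => /andP[_ /andP[_]].
rewrite psiE /root !(hornerE, horner_exp) /= => /eqP <-; apply/eqP; ring.
Qed.

Fixpoint degree_le z (Z : 'M[F]_(z, d)) m (psi : 'rV[F]_d -> F) : Prop :=
  if m is m'.+1 then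
    forall w, w \in affine Z 0 -> degree_le Z m' (fun y => psi (y + w) - psi y)
  else forall y w, w \in affine Z 0 -> psi (y + w) = psi y.

(** A difference of [psi] can only be nonzero where one of two values of [psi] is,
    so that lowering the degree by one costs a factor 2. *)
Lemma card_degree_le_nonzeros z (Z : 'M_(z, d)) m tau psi y0 :
    degree_le Z m psi -> y0 \in affine Z tau -> psi y0 != 0 ->
  (#|affine Z 0| <= 2 ^ m * #|[set y in affine Z tau | psi y != 0%R]|)%N.
Proof.
elim: m psi y0 => [|m IH] psi y0 /= deg_psi y0E psi0.
  rewrite mul1n -(card_affine_nonempty y0E); apply/subset_leq_card/subsetP => y yE.
  rewrite inE yE -[y](subrK y0) addrC deg_psi //.
  by rewrite -(mem_affineD _ y0E) addrC subrK.
set S := [set y in _ | _].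
have [/exists_inP[w wE /exists_inP[y yE psiy]]|/exists_inPn h] :=
    boolP [exists w in affine Z 0, [exists y in affine Z tau, psi (y + w) != psi y]].
  have := IH _ y (deg_psi w wE) yE; rewrite subr_eq0 => /(_ psiy) le_m.
  apply: leq_trans le_m _; rewrite expnSr -mulnA leq_mul2l mul2n -addnn.
  apply/orP; right; set S' := [set _ in _ | _].
  have sub : S' \subset S :|: [set x - w | x in S].
    apply/subsetP => x; rewrite inE => /andP[xE dx].
    have [psix|psix] := eqVneq (psi x) 0; last by rewrite in_setU inE xE psix.
    rewrite in_setU; apply/orP; right; apply/imsetP; exists (x + w); rewrite ?addrK //.
    by rewrite inE mem_affineD // wE; move: dx; rewrite psix subr0.
  apply: leq_trans (subset_leq_card sub) _; apply: leq_trans (leq_card_setU _ _) _.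
  by rewrite leq_add2l leq_imset_card.
apply: (@leq_trans #|S|); last by rewrite leq_pmull ?expn_gt0.
rewrite -(card_affine_nonempty y0E); apply/subset_leq_card/subsetP => y yE.
have wE : y - y0 \in affine Z 0 by rewrite -(mem_affineD _ y0E) addrC subrK.
have /exists_inPn/(_ y0 y0E) := h _ wE; rewrite negbK addrC subrK => /eqP psiy.
by rewrite inE yE psiy.
Qed.

End AffineCounting.

(** * Copies of a tuple of vectors *)

Section Copies.
Variables (F : finFieldType) (d k : nat) (v : nat -> 'rV[F]_d).
Hypothesis F2 : 2%:R != 0 :> F.
Hypothesis k_lt_d : (k < d)%N.
Local Notation q := #|F|.

Definition gram n (Y : 'M[F]_(n, d)) : 'M_n := Y *m Y^T.

(** New vectors are put on top, so that the number of rows is a successor by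
    conversion. *)
Fixpoint stack n : 'M[F]_(n, d) :=
  if n is m.+1 return 'M_(n, d) then col_mx (v m) (stack m) else 0.

Hypothesis gram_unit : gram (stack k) \in unitmx.

Definition copies n : {set 'M[F]_(n, d)} :=
  [set Y | row_free Y && (gram Y == gram (stack n))].

Definition fibre n (Y : 'M[F]_(n, d)) : {set 'rV_d} :=
  [set y | (y *m Y^T == v n *m (stack n)^T) && (dot y y == dot (v n) (v n))].

Lemma gram_col_mx n (y y' : 'rV[F]_d) (Y Y' : 'M_(n, d)) :
  (gram (col_mx y Y) == gram (col_mx y' Y')) =
  [&& gram Y == gram Y', y *m Y^T == y' *m Y'^T & dot y y == dot y' y'].
Proof.
rewrite /gram !tr_col_mx !mul_col_row !dotE; apply/eqP/and3P.
  move=> /eq_block_mx[/matrixP/(_ 0 0)]; rewrite !mxE eqxx !mulr1n => -> -> _ ->.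
  by rewrite !eqxx.
case=> /eqP -> /eqP yY /eqP ->.
have Yy (u : 'rV[F]_d) (U : 'M[F]_(n, d)) : U *m u^T = (u *m U^T)^T.
  by rewrite trmx_mul trmxK.
by rewrite (Yy y) (Yy y') yY.
Qed.

Lemma copies_col_mx n (y : 'rV_d) (Y : 'M_(n, d)) :
  (col_mx y Y \in copies n.+1) =
  [&& Y \in copies n, y \in fibre Y & ~~ (y <= Y)%MS].
Proof.
rewrite !inE row_free_col_mx gram_col_mx.
by case: row_free; rewrite ?andbF //=; case: (y <= Y)%MS; rewrite ?andbF ?andbT.
Qed.

Lemma stack_sub n m : (n <= m)%N -> exists J, stack n = J *m stack m.
Proof.
move=> /subnK <-; elim: (m - n)%N => [|l [J JE]].
  by exists 1%:M; rewrite mul1mx.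
exists (row_mx (0 : 'M[F]_(n, 1)) J : 'M_(n, l.+1 + n)); rewrite JE /=.
by rewrite (mul_row_col (0 : 'M[F]_(n, 1)) J) mul0mx add0r.
Qed.

Lemma stack_free n : (n <= k)%N -> row_free (stack n).
Proof.
have free_k : row_free (stack k).
  rewrite /row_free eqn_leq rank_leq_row /= -{1}(mxrank_unit gram_unit).
  exact: mxrankM_maxl.
move=> /subnK kE; move: free_k; rewrite -kE; elim: (k - n)%N => // m IH.
by rewrite addSn /= row_free_col_mx => /andP[/IH].
Qed.

Lemma stack_copies n : (n <= k)%N -> stack n \in copies n.
Proof. by move=> n_le; rewrite inE stack_free // eqxx. Qed.

(** Removing one row and the corresponding column lowers the rank by at most 2. *)
Lemma rank_gram_stack n : (n <= k)%N -> (2 * n <= k + \rank (gram (stack n)))%N.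
Proof.
move=> n_le; have [J JE] := stack_sub n_le.
have T_unit := gram_unit; set T := gram (stack k) in T_unit.
have rJ : \rank J = n.
  apply/eqP; rewrite eqn_leq rank_leq_row /= -{1}(eqP (stack_free n_le)) JE.
  exact: mxrankM_maxl.
have -> : gram (stack n) = J *m T *m J^T.
  by rewrite /gram JE trmx_mul !mulmxA.
have := mxrank_Frobenius J T J^T; rewrite (mxrank_unit T_unit).
have -> : \rank (J *m T) = n by rewrite mxrankMfree ?rJ // row_free_unit.
have -> : \rank (T *m J^T) = n.
  by rewrite -mxrank_tr trmx_mul trmxK mxrankMfree ?rJ // row_free_unit unitmx_tr.
by rewrite mul2n addnn.
Qed.

(** If the norm were constant on the affine space, its direction would be totally
    isotropic and orthogonal to the base point, so that both lie in the span of
    [Z]. The Gram matrix of the copy extended by the base point then has rank at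
    most [2 z - d], less than [rank_gram_stack] allows. *)
Lemma dot_not_constant n z (Y : 'M_(n, d)) (Z : 'M_(z, d)) (y0 : 'rV_d) :
    (n < k)%N -> Y \in copies n -> row_free Z -> (z <= n.+1)%N -> (Y <= Z)%MS ->
    y0 *m Y^T = v n *m (stack n)^T ->
  exists2 y1, y1 \in affine Z (y0 *m Z^T) & dot y1 y1 != dot (v n) (v n).
Proof.
move=> n_lt; rewrite inE => /andP[free_Y /eqP gramY] free_Z z_le YZ y0Y.
set tau := y0 *m Z^T.
have [/exists_inP//|/exists_inPn h] :=
  boolP [exists y in affine Z tau, dot y y != dot (v n) (v n)].
have dot_const y : y \in affine Z tau -> dot y y = dot (v n) (v n).
  by move/h; rewrite negbK => /eqP.
have y0E : y0 \in affine Z tau by rewrite inE.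
have dotW w : w \in affine Z 0 -> dot w w = 0 /\ dot y0 w = 0.
  move=> wE; have NwE : - w \in affine Z 0.
    by move: wE; rewrite !inE mulNmx oppr_eq0.
  have := dot_const (y0 + w); have := dot_const (y0 - w).
  rewrite !mem_affineD // => /(_ NwE) + /(_ wE); rewrite -(dot_const y0) //.
  rewrite !dot_linear [dot w y0]dotC => e1 e2.
  have e3 : 2%:R * (2%:R * dot y0 w) = 0.
    transitivity ((dot y0 y0 + dot y0 w + (dot y0 w + dot w w)) -
      (dot y0 y0 - dot y0 w + (- dot y0 w - - dot w w))); first by ring.
    by rewrite e1 e2 subrr.
  have y0w : dot y0 w = 0 by move/eqP: e3; rewrite !mulf_eq0 (negPf F2) /= => /eqP.
  split=> //; move: e2; rewrite y0w !addr0 add0r => /eqP.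
  by rewrite addrC -subr_eq0 addrK => /eqP.
pose K := kermx Z^T.
have KZ : K *m Z^T = 0 by apply/eqP; rewrite -sub_kermx.
have rK : \rank K = (d - z)%N by rewrite mxrank_ker mxrank_tr (eqP free_Z).
have rowK i : row i K \in affine Z 0 by rewrite inE -row_mul KZ row0.
have KK : K *m K^T = 0.
  by apply: isotropic_kermx => // w wZ; have [|//] := dotW w; rewrite inE wZ.
have Ky0 : y0 *m K^T = 0.
  by apply/rowP => i; rewrite mulmx_dot mxE; have [_ ->] := dotW _ (rowK i).
have perp_Z m (X : 'M_(m, d)) : X *m K^T = 0 -> (X <= Z)%MS.
  exact: sub_perp_kermx.
have [M ME] : exists M, col_mx y0 Y = M *m Z.
  by apply/submxP; rewrite col_mx_sub perp_Z.
have [B BE] : exists B, K = B *m Z by apply/submxP; rewrite perp_Z.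
(* The [d - z] independent rows of [B] lie in the kernel of [gram Z]. *)
have rZ : (\rank (gram Z) + d <= 2 * z)%N.
  have := mulmx0_rank_max (_ : B *m gram Z = 0).
  rewrite /gram mulmxA -BE KZ => /(_ erefl).
  have : (d - z <= \rank B)%N by rewrite -rK BE mxrankM_maxl.
  have : (z <= d)%N by rewrite -(eqP free_Z) rank_leq_col.
  lia.
have gramE : gram (stack n.+1) = M *m gram Z *m M^T.
  rewrite /gram mulmxA -mulmxA -trmx_mul -ME; apply/eqP.
  rewrite eq_sym -[_ *m _]/(gram (col_mx y0 Y)) gram_col_mx gramY eqxx.
  by rewrite y0Y eqxx (dot_const y0) ?eqxx.
have := rank_gram_stack n_lt; rewrite gramE.
have : (\rank (M *m gram Z *m M^T) <= \rank (gram Z))%N.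
  by rewrite (leq_trans (mxrankM_maxl _ _)) // mxrankM_maxr.
move: rZ => + + + ; move: (\rank _) (\rank _) => r1 r2 h1 h2 h3; exfalso; lia.
Qed.

End Copies.

(** * Upper bounds for numbers of copies *)

Section Volume.
Variables (F : finFieldType) (d : nat).
Local Notation q := #|F|.

(** Expected numbers of copies of the first [n] vectors, and of those with
    prescribed products with one further vector. *)
Definition volume n := (\prod_(i < n) q ^ (d - i.+1))%N.
Definition slice_volume n := (\prod_(i < n) q ^ (d - i.+2))%N.

Lemma volume_slice n : (n < d)%N -> (q ^ n * slice_volume n = volume n)%N.
Proof.
move=> n_lt; rewrite -{1}[n]card_ord -prod_nat_const -big_split /=.
by apply: eq_bigr => i _; rewrite -expnS; congr (q ^ _)%N; have := ltn_ord i; lia.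
Qed.

End Volume.

Section CopyCounts.
Variables (F : finFieldType) (d k : nat) (v : nat -> 'rV[F]_d).
Hypothesis F2 : 2%:R != 0 :> F.
Hypothesis k_lt_d : (k < d)%N.
Hypothesis gram_unit : gram (stack v k) \in unitmx.
Local Notation q := #|F|.
Local Notation copies := (copies v).
Local Notation fibre := (fibre v).
Local Notation stack := (stack v).

Let q_gt2 : (2 < q)%N := card_odd_field F2.
Let q_gt0 : (0 < q)%N. Proof. by apply: leq_trans q_gt2. Qed.
Local Notation volume := (volume F d).
Local Notation slice_volume := (slice_volume F d).

(** On the affine space the norm differs somewhere from the prescribed one by
    [dot_not_constant], so that the sphere is the zero set of a quadratic
    function that is not identically zero. *)
Lemma card_sphere_affine n z (Y : 'M_(n, d)) (Z : 'M_(z, d)) tau :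
    (n < k)%N -> Y \in copies n -> row_free Z -> (z <= n.+1)%N -> (Y <= Z)%MS ->
  (#|[set y in fibre Y | y \in affine Z tau]| <= 3 * q ^ (d - z.+1))%N.
Proof.
move=> n_lt Ycop free_Z z_le YZ; set S := [set y in _ | _].
have [->|[y0]] := set_0Vmem S; first by rewrite cards0.
rewrite !inE => /andP[/andP[/eqP y0Y _] /eqP y0Z].
have [y1 y1E psi1] := dot_not_constant F2 k_lt_d gram_unit n_lt Ycop free_Z z_le YZ y0Y.
rewrite y0Z in y1E; rewrite -subr_eq0 in psi1.
pose psi (y : 'rV[F]_d) := dot y y - dot (v n) (v n).
have := card_quadratic_zeros F2 (psi := psi) y1E psi1.
have -> : (q * #|[set y in affine Z tau | psi y == 0%R]| <= 3 * #|affine Z 0|)%N =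
  (#|[set y in affine Z tau | psi y == 0%R]| <= 3 * q ^ (d - z.+1))%N.
  rewrite card_affine // (_ : (d - z = (d - z.+1).+1)%N); last by lia.
  by rewrite expnS mulnCA leq_mul2l -leqn0 leqNgt q_gt0.
move=> le; apply: leq_trans (le _); last first.
  move=> u _; exists (2%:R * dot y1 u), (dot u u) => l.
  by rewrite /psi !dot_linear [dot u y1]dotC; ring.
apply/subset_leq_card/subsetP => y; rewrite !inE => /andP[/andP[_ /eqP dy] yZ].
by rewrite yZ /psi dy subrr /=.
Qed.

Lemma card_fibre_le n (Y : 'M_(n, d)) : (n < k)%N -> Y \in copies n ->
  (#|fibre Y| <= 3 * q ^ (d - n.+1))%N.
Proof.
move=> n_lt Ycop; have free_Y : row_free Y by move: Ycop; rewrite inE => /andP[].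
have := card_sphere_affine (v n *m (stack n)^T) n_lt Ycop free_Y (leqnSn n) (submx_refl Y).
apply: leq_trans; apply/subset_leq_card/subsetP => y; rewrite !inE => yE.
by rewrite yE; case/andP: yE.
Qed.

(** As long as [xi] is not in the span of the vectors already chosen, its product
    with the next one is an independent linear condition. *)
Lemma card_slice_le n (xi : 'rV_d) (eta : 'rV_n) : (n <= k)%N ->
  (#|[set Y in copies n | ~~ (xi <= Y)%MS & xi *m Y^T == eta]|
     <= 3 ^ n * slice_volume n)%N.
Proof.
elim: n eta => [|n IH] eta n_le.
  rewrite /slice_volume big_ord0 muln1 expn0.
  by apply: leq_trans (max_card _) _; rewrite card_mx mul0n.
rewrite (@card_col_mx F d n (fun Y => [&& Y \in copies n.+1, ~~ (xi <= Y)%MS & xi *m Y^T == eta])).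
pose S := [set Y in copies n | ~~ (xi <= Y)%MS & xi *m Y^T == rsubmx (eta : 'rV_(1 + n))].
apply: (@leq_trans (\sum_(Y in S) 3 * q ^ (d - n.+2))%N); last first.
  rewrite sum_nat_const /slice_volume big_ord_recr /= expnS.
  have := IH (rsubmx (eta : 'rV_(1 + n))) (ltnW n_le); rewrite -/S /slice_volume.
  by move: #|S| (\prod_(_ < n) _)%N => s P; nia.
rewrite [X in (_ <= X)%N]big_mkcond /=; apply: leq_sum => Y _; rewrite [Y \in S]inE.
case: ifP => [/and3P[Ycop xiY _]|notS].
  have free_Y : row_free Y by move: Ycop; rewrite inE => /andP[].
  have free_xiY : row_free (col_mx xi Y) by rewrite row_free_col_mx free_Y.
  have Y_le : (Y <= col_mx xi Y)%MS by rewrite -addsmxE addsmxSr.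
  have := card_sphere_affine (row_mx (lsubmx (eta : 'rV_(1 + n)))
    (v n *m (stack n)^T)) n_le Ycop free_xiY (leqnn _) Y_le.
  apply: leq_trans; apply/subset_leq_card/subsetP => y.
  rewrite in_set copies_col_mx => /and3P[/and3P[_ yfib _] _ /eqP etaE].
  rewrite in_set yfib in_set tr_col_mx mul_mx_row; apply/eqP; congr row_mx.
    move: etaE; rewrite tr_col_mx mul_mx_row => /(congr1 lsubmx); rewrite row_mxKl => <-.
    by rewrite !dotE dotC.
  by move: yfib; rewrite inE => /andP[/eqP].
rewrite leqn0 cards_eq0; apply/eqP/setP => y; rewrite in_set in_set0.
apply: contraFF notS; rewrite copies_col_mx => /and3P[/and3P[-> _ _] xiY /eqP <-] /=.
rewrite tr_col_mx mul_mx_row row_mxKr eqxx andbT.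
by apply: contra xiY => xiY; rewrite -addsmxE (submx_trans xiY) ?addsmxSr.
Qed.

(** A vector of the span of a copy involving its last vector determines that
    vector from the others and the coefficients. *)
Lemma card_span_le n (xi : 'rV_d) : (n <= k)%N -> xi != 0 ->
  (#|[set Y in copies n | (xi <= Y)%MS]| * q ^ (d - n.+1) <= 3 ^ n * volume n)%N.
Proof.
move=> + xi0; elim: n => [|n IH] n_le.
  rewrite (_ : [set Y in _ | _] = set0) ?cards0 //; apply/setP => Y.
  rewrite !inE; apply/negbTE; rewrite negb_and; apply/orP; right.
  by apply: contra xi0 => /submxP[D ->]; rewrite (flatmx0 Y) mulmx0.
rewrite (@card_col_mx F d n (fun Y => (Y \in copies n.+1) && (xi <= Y)%MS)).
pose A (Y : 'M_(n, d)) := if (Y \in copies n) && (xi <= Y)%MS then #|fibre Y| else 0%N.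
pose B (Y : 'M_(n, d)) := if (Y \in copies n) && ~~ (xi <= Y)%MS
  then #|[set y in fibre Y | ~~ (y <= Y)%MS && (xi <= col_mx y Y)%MS]| else 0%N.
have AB (Y : 'M[F]_(n, d)) :
  (#|[set y : 'rV[F]_d | (col_mx y Y \in copies n.+1) && (xi <= col_mx y Y)%MS]|
    <= A Y + B Y)%N.
  rewrite /A /B; case Ycop: (Y \in copies n); last first.
    rewrite leqn0 cards_eq0; apply/eqP/setP => y; rewrite in_set in_set0.
    by rewrite copies_col_mx Ycop.
  case xiY: (xi <= Y)%MS; rewrite /= ?addn0 ?add0n.
    apply/subset_leq_card/subsetP => y; rewrite in_set copies_col_mx.
    by case/andP => /and3P[].
  apply/subset_leq_card/subsetP => y; rewrite in_set copies_col_mx.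
  by move=> /andP[/and3P[_ yfib yY] h]; rewrite in_set yfib yY h.
apply: (@leq_trans ((\sum_Y A Y + \sum_Y B Y) * q ^ (d - n.+2))%N).
  by rewrite leq_mul2r -big_split leq_sum ?orbT // => Y _.
have sumA : (\sum_Y A Y <= 3 * 3 ^ n * volume n)%N.
  apply: (@leq_trans (\sum_(Y in [set Y in copies n | (xi <= Y)%MS]) 3 * q ^ (d - n.+1))%N).
    rewrite [X in (_ <= X)%N]big_mkcond /=; apply: leq_sum => Y _.
    rewrite /A [Y \in [set _ in _ | _]]in_set; case: ifP => // /andP[Ycop _].
    exact: card_fibre_le.
  by rewrite sum_nat_const; have := IH (ltnW n_le); nia.
have sumB : (\sum_Y B Y <= 3 ^ n * (q * volume n))%N.
  (* The last vector [y] of such a copy is [l *: xi + c *m Y] with [l != 0], and its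
   products with [Y] then determine those of [xi]. *)
  pose R (Y : 'M_(n, d)) (lc : F * 'rV[F]_n) := [&& Y \in copies n, ~~ (xi <= Y)%MS,
    lc.1 != 0 & xi *m Y^T == lc.1^-1 *: (v n *m (stack n)^T - lc.2 *m gram (stack n))].
  apply: (@leq_trans (\sum_Y \sum_(lc | R Y lc) 1)%N).
    apply: leq_sum => Y _; rewrite /B sum1dep_card; case: ifP => // /andP[Ycop xiY].
    pose h (lc : F * 'rV_n) : 'rV_d := lc.1 *: xi + lc.2 *m Y.
    apply: leq_trans (leq_imset_card h _); apply/subset_leq_card/subsetP => y.
    rewrite inE => /andP[yfib /andP[yY /submxP[D]]].
    rewrite -[D]hsubmxK mul_row_col; set a := lsubmx D; set c := rsubmx D => xiE.
    have aE : a = (a 0 0)%:M by rewrite -mx11_scalar.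
    rewrite aE mul_scalar_mx in xiE; set l := a 0 0 in xiE.
    have l0 : l != 0.
      by apply: contraNneq xiY => l0; rewrite xiE l0 scale0r add0r submxMl.
    have yE : y = l^-1 *: xi + (- (l^-1 *: c)) *m Y.
      by rewrite xiE scalerDr scalerA mulVf // scale1r mulNmx scalemxAl addrK.
    apply/imsetP; exists (l^-1, - (l^-1 *: c)) => //.
    rewrite in_set /R Ycop xiY invr_eq0 l0 /= invrK.
    move: yfib; rewrite inE => /andP[/eqP <- _].
    move: (Ycop); rewrite inE => /andP[_ /eqP <-].
    by rewrite yE mulmxDl -mulmxA addrK -scalemxAl scalerA divff // scale1r.
  rewrite (exchange_big_dep (fun lc => lc.1 != 0)) /= => [|Y lc _ /and4P[]//].
  apply: (@leq_trans (\sum_(lc : F * 'rV[F]_n) 3 ^ n * slice_volume n)%N).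
    rewrite [X in (X <= _)%N]big_mkcond /=; apply: leq_sum => -[l c] _ /=.
    case: ifP => // l0; rewrite sum1dep_card.
    apply: leq_trans (card_slice_le xi (l^-1 *: (v n *m (stack n)^T - c *m gram (stack n))) (ltnW n_le)).
    apply/subset_leq_card/subsetP => Y; rewrite in_set => /and4P[Yc xiY _ h].
    by rewrite in_set Yc xiY.
  rewrite sum_nat_const card_prod card_rV -(volume_slice F (ltn_trans n_le k_lt_d)).
  by apply: eq_leq; ring.
have volS : volume n.+1 = (volume n * (q * q ^ (d - n.+2)))%N.
  by rewrite /volume big_ord_recr /= -expnS; congr (_ * q ^ _)%N; lia.
rewrite volS expnS; move: sumA sumB q_gt2.
move: q (\sum_Y A Y)%N (\sum_Y B Y)%N (volume n) (q ^ (d - n.+2))%N (3 ^ n)%N.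
move=> q' a b V Q t sumA sumB q'_gt2.
apply: (@leq_trans (3 * (t * V * q') * Q)); last by apply: eq_leq; ring.
rewrite leq_mul2r; apply/orP; right; move: sumA sumB.
have -> : (3 * t * V = 3 * (t * V))%N by ring.
have -> : (t * (q' * V) = (t * V) * q')%N by ring.
by move: (t * V)%N => w; nia.
Qed.

End CopyCounts.

(** * Fourier analysis of a fibre *)

(** In Gauss sums the count is exactly [q - 1] or [q + 1]. *)
Lemma card_conic (F : finFieldType) (alpha beta u : F) : 2%:R != 0 :> F ->
    alpha != 0 -> beta != 0 -> u != 0 ->
  (#|F| <= #|[set z : F * F | (beta * z.1 ^+ 2 + alpha * z.2 ^+ 2)%R == u]| + 1)%N.
Proof.
move=> F2 alpha0 beta0 u0; set N := #|_|; have [e] := addchar_exists F.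
pose g2 := quadchar (beta * alpha) * gauss e 1 ^+ 2.
have eqN : #|F|%:R * N%:R = #|F|%:R ^+ 2 - g2 :> algC.
  transitivity (\sum_(z : F * F) \sum_s e (s * (beta * z.1 ^+ 2 + alpha * z.2 ^+ 2 - u))).
    under eq_bigr do rewrite sum_addcharM subr_eq0.
    rewrite -mulr_sumr -natr_sum; congr (_ * _%:R).
    by rewrite /N -sum1dep_card [LHS]big_mkcond; apply: eq_bigr => z _; case: eqP.
  rewrite exchange_big (bigD1 0) //=; congr (_ + _).
    under eq_bigr do rewrite mul0r addchar0.
    by rewrite sumr_const card_prod natrM.
  transitivity (\sum_(s | s != 0) g2 * e (s * (- u))).
    apply: eq_bigr => s s0.
    have -> : g2 = gauss e (s * beta) * gauss e (s * alpha).
      rewrite (gauss_quadchar e F2 (mulf_neq0 s0 beta0)).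
      rewrite (gauss_quadchar e F2 (mulf_neq0 s0 alpha0)) /g2 !quadcharM //.
      by rewrite -[LHS]mul1r -(quadchar2 F2 s0); ring.
    rewrite /gauss mulr_suml mulr_suml.
    under [RHS]eq_bigr do rewrite mulr_sumr mulr_suml.
    rewrite pair_bigA; apply: eq_bigr => -[x y] _ /=.
    by rewrite -!addcharD; congr (e _); ring.
  rewrite -mulr_sumr sum_addchar_neq0 oppr_eq0 (negPf u0) mulr0 sub0r mulrN1 //.
have norm_g2 : `|g2| = #|F|%:R.
  by rewrite /g2 normrM quadchar_norm ?mulf_neq0 // mul1r normrX gauss_norm ?oner_neq0.
have g2_real : g2 \is Num.real.
  have -> : g2 = #|F|%:R ^+ 2 - #|F|%:R * N%:R by rewrite eqN opprB addrC subrK.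
  by rewrite rpredB ?rpredX ?rpredM ?realn.
have : g2 <= #|F|%:R by rewrite -norm_g2 real_ler_norm.
have -> : g2 = #|F|%:R ^+ 2 - #|F|%:R * N%:R by rewrite eqN opprB addrC subrK.
rewrite lerBlDr -natrX -natrM -natrD ler_nat -mulnS -mulnn.
by rewrite leq_pmul2l ?addn1 // (ltnW (finNzRing_gt1 F)).
Qed.

Section FibreFourier.
Variables (F : finFieldType) (d k : nat) (v : nat -> 'rV[F]_d).
Hypothesis F2 : 2%:R != 0 :> F.
Hypothesis k_lt_d : (k < d)%N.
Hypothesis gram_unit : gram (stack v k) \in unitmx.
Variable e : addchar F.
Local Notation q := #|F|.
Local Notation copies := (copies v).
Local Notation fibre := (fibre v).
Local Notation stack := (stack v).

Definition fibre_sum n (Y : 'M[F]_(n, d)) (xi : 'rV_d) : algC :=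
  \sum_(y in fibre Y) e (dot y xi).

Definition face_norm n (c : 'rV_n) : F :=
  dot (v n + c *m stack n) (v n + c *m stack n).

Definition fibre_kernel n (b : F) (c : 'rV_n) : algC :=
  twisted_sum e d (face_norm c) b.

Lemma gram_copies n (Y : 'M_(n, d)) (c : 'rV_n) : Y \in copies n ->
  dot (c *m Y) (c *m Y) = dot (c *m stack n) (c *m stack n).
Proof.
rewrite inE => /andP[_ /eqP gramY].
by rewrite !dot_mulmx -!mulmxA -!/(gram _) gramY.
Qed.

Lemma sum_affine_char n (Y : 'M_(n, d)) tau (xi : 'rV_d) : row_free Y ->
    (xi == 0) || ~~ (xi <= Y)%MS ->
  q%:R ^+ n * \sum_(y in affine Y tau) e (dot y xi) = q%:R ^+ d * (xi == 0)%:R.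
Proof.
move=> free_Y; have n_le : (n <= d)%N by rewrite -(eqP free_Y) rank_leq_col.
have [-> _|xi0 /= xiY] := eqVneq xi 0.
  under eq_bigr do rewrite dot0r addchar0.
  by rewrite sumr_const card_affine // natrX -exprD subnKC // mulr1.
rewrite mulr0; have [w wE xiw] : exists2 w, w \in affine Y 0 & dot w xi != 0.
  apply/exists_inP; apply: contraR xiY => /exists_inPn h.
  apply: sub_perp_kermx free_Y _; apply/rowP => j; rewrite mulmx_dot mxE.
  have := h (row j (kermx Y^T)); rewrite negbK dotC => /(_ _)/eqP -> //.
  by rewrite inE -row_mul mulmx_ker row0.
have [b b1] := addchar_scale_neq1 e xiw.
rewrite (@sum_char0 _ (fun y : 'rV_d => e (dot y xi)) (mem (affine Y tau)) (b *: w)) ?mulr0 //=.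
- by move=> y z; rewrite dotDl addcharD.
- move=> y; rewrite !inE mulmxDl -scalemxAl.
  by move: wE; rewrite inE => /eqP ->; rewrite scaler0 addr0.
by rewrite dotZl.
Qed.

(** The conditions on the products with [Y] are detected by characters with
    parameter [2 s c], the condition on the norm by those with parameter [s]. For
    [s != 0], completing the square in [y] replaces the sum over [y] by a Gauss
    sum, and leaves a quadratic function of [c] in which [Y] occurs only through
    its Gram matrix and its products with [xi]. For [s = 0] one sums a character
    over an affine space with direction orthogonal to [Y]. *)
Lemma fibre_sumE n (Y : 'M_(n, d)) (xi : 'rV_d) :
    Y \in copies n -> (xi == 0) || ~~ (xi <= Y)%MS ->
  q%:R ^+ n.+1 * fibre_sum Y xi = q%:R ^+ d * (xi == 0)%:R +
    fourier e (fibre_kernel (dot xi xi / 4%:R)) (- (xi *m Y^T)).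
Proof.
move=> Ycop xiY; have free_Y : row_free Y by move: (Ycop); rewrite inE => /andP[].
set t := v n *m (stack n)^T; set t0 := dot (v n) (v n).
have -> : q%:R ^+ n.+1 * fibre_sum Y xi = q%:R ^+ n *
    \sum_s \sum_(y in affine Y t) e (s * (dot y y - t0) + dot y xi).
  rewrite exprSr -mulrA; congr (_ * _); rewrite exchange_big /= mulr_sumr.
  rewrite big_mkcond [RHS]big_mkcond; apply: eq_bigr => y _; rewrite !inE -/t.
  case: eqP => //= _; rewrite [RHS](_ : _ = (\sum_s e (s * (dot y y - t0))) * e (dot y xi)).
    by rewrite sum_addcharM subr_eq0; case: eqP; rewrite ?mulr1 // mulr0 mul0r.
  by rewrite mulr_suml; apply: eq_bigr => s _; rewrite addcharD.
rewrite (bigD1 0) //= mulrDr; congr (_ + _).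
  under eq_bigr do rewrite mul0r add0r.
  exact: sum_affine_char.
rewrite /fourier /fibre_kernel /twisted_sum mulr_sumr.
under [RHS]eq_bigr do rewrite mulr_suml.
rewrite [RHS]exchange_big; apply: eq_bigr => s s0 /=.
have s20 : 2%:R * s != 0 by rewrite mulf_neq0.
transitivity (\sum_c \sum_y e (s * dot y y + dot (xi + (2%:R * s) *: (c *m Y)) y) *
    e (- (s * t0) - 2%:R * s * dot c t)).
  rewrite exchange_big mulr_sumr big_mkcond /=; apply: eq_bigr => y _.
  transitivity (e (s * (dot y y - t0) + dot y xi) *
      \sum_c e (dot ((2%:R * s) *: c) (y *m Y^T - t))).
    have -> : \sum_c e (dot ((2%:R * s) *: c) (y *m Y^T - t)) =
        \sum_c e (dot c (y *m Y^T - t)) by rewrite [RHS](reindex_inj (scalerI s20)).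
    by rewrite sum_char_dot subr_eq0 inE; case: eqP => _; rewrite ?mulr0 // mulr1 mulrC.
  rewrite mulr_sumr; apply: eq_bigr => c _; rewrite -!addcharD; congr (e _).
  by rewrite !dot_linear dot_mulmx [dot y xi]dotC; ring.
apply: eq_bigr => c _; rewrite -mulr_suml sum_quadratic // -!mulrA -!addcharD.
congr (_ * e _); rewrite /face_norm !dot_linear gram_copies //.
rewrite [dot xi (c *m Y)]dotC (dot_mulmx c Y xi).
have -> : dot c t = dot (c *m stack n) (v n) by rewrite dot_mulmx.
by rewrite [dot (v n) (c *m _)]dotC -/t0; field; rewrite s0 four_neq0.
Qed.

(** For [xi = 0] the right side of [fibre_sumE] does not involve [Y]. *)
Lemma card_fibre_const n (Y Y' : 'M_(n, d)) :
  Y \in copies n -> Y' \in copies n -> #|fibre Y| = #|fibre Y'|.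
Proof.
have S0 X : fibre_sum X (0 : 'rV_d) = #|fibre (X : 'M_(n, d))|%:R.
  rewrite /fibre_sum; under eq_bigr do rewrite dot0r addchar0.
  by rewrite sumr_const.
move=> Ycop Ycop'; apply/eqP; rewrite -(eqr_nat algC) -!S0.
have q0 : (q%:R : algC) ^+ n.+1 != 0.
  by rewrite expf_neq0 // pnatr_eq0 -lt0n (ltnW (finNzRing_gt1 F)).
by rewrite -(inj_eq (mulfI q0)) !fibre_sumE ?eqxx // !mul0mx.
Qed.

End FibreFourier.

(** * Lower bound for the size of a fibre *)

Section FibreLower.
Variables (F : finFieldType) (d k : nat) (v : nat -> 'rV[F]_d).
Hypothesis F2 : 2%:R != 0 :> F.
Hypothesis k_lt_d : (k < d)%N.
Hypothesis gram_unit : gram (stack v k) \in unitmx.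
Local Notation q := #|F|.
Local Notation copies := (copies v).
Local Notation fibre := (fibre v).
Local Notation stack := (stack v).

(** Otherwise the orthogonal complement of the vectors would be totally
    isotropic, hence contained in their span, where the form is nondegenerate. *)
Lemma anisotropic_perp : exists2 a : 'rV_d, a *m (stack k)^T = 0 & dot a a != 0.
Proof.
have free_k := stack_free gram_unit (leqnn k).
pose K := kermx (stack k)^T; have KS : K *m (stack k)^T = 0 by exact: mulmx_ker.
have [/exists_inP[a]|/exists_inPn h] :=
    boolP [exists a in affine (stack k) 0, dot a a != 0].
  by rewrite inE => /eqP aE aa; exists a.
have iso w : w *m (stack k)^T = 0 -> dot w w = 0.
  by move=> wE; have := h w; rewrite inE wE eqxx negbK => /(_ isT)/eqP.
have KK : K *m K^T = 0 by exact: isotropic_kermx.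
have /submxP[B BE] := sub_perp_kermx free_k KK.
have B0 : B = 0.
  apply: (row_free_inj (_ : row_free (gram (stack k)))).
    by rewrite row_free_unit.
  by rewrite mul0mx mulmxA -BE.
have : \rank K = 0%N by rewrite BE B0 mul0mx mxrank0.
by rewrite mxrank_ker mxrank_tr (eqP free_k) => /eqP; rewrite subn_eq0 leqNgt k_lt_d.
Qed.

Lemma dual_vector n : (n < k)%N -> exists b : 'rV_d,
  [/\ (b <= stack k)%MS, b *m (stack n)^T = 0 & dot b (v n) = 1].
Proof.
move=> n_lt; pose A := stack k *m (stack n.+1)^T.
have full_A : row_full A.
  have [J JE] := stack_sub v n_lt.
  have AE : A = gram (stack k) *m J^T by rewrite /A JE trmx_mul mulmxA.
  rewrite /row_full -mxrank_tr AE trmx_mul trmxK mxrankMfree.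
    rewrite eqn_leq rank_leq_row -{1}(eqP (stack_free gram_unit n_lt)) JE.
    exact: mxrankM_maxl.
  by rewrite row_free_unit unitmx_tr.
pose r : 'rV[F]_(1 + n) := row_mx 1%:M 0.
have /submxP[c cE] := submx_full r full_A.
have cr : c *m stack k *m (col_mx (v n) (stack n))^T = r by rewrite -mulmxA.
exists (c *m stack k); move: cr; rewrite tr_col_mx mul_mx_row => /eq_row_mx[b1 b0]; split=> //.
  exact: submxMl.
by move: b1; rewrite dotE => /matrixP/(_ 0 0); rewrite !mxE eqxx !mulr1n.
Qed.

(** The number of points of a fibre is the same for every copy, and is estimated
    for the original vectors, whose fibre contains [v n]. An anisotropic [a]
    orthogonal to all of them, and a [b] in their span with product 1 with [v n]
    and 0 with the earlier ones, span a plane. On a translate of this plane the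
    sphere is a conic, with at least [q - 1] points unless a quadratic function
    [psi] of the translate vanishes; and [psi] does not vanish at [v n]. *)
Lemma card_fibre_ge n (Y : 'M_(n, d)) : (n < k)%N -> Y \in copies n ->
  (q ^ (d - n.+1) <= 6 * #|fibre Y|)%N.
Proof.
move=> n_lt Ycop; have [e] := addchar_exists F.
have n_le := ltnW n_lt; have q_gt2 := card_odd_field F2.
rewrite (card_fibre_const F2 e Ycop (stack_copies gram_unit n_le)).
have free_n := stack_free gram_unit n_le.
have [a aS aa] := anisotropic_perp.
have [b [bS bn bv]] := dual_vector n_lt.
set t := v n *m (stack n)^T; set t0 := dot (v n) (v n).
have a_perp m (X : 'M_(m, d)) : (X <= stack k)%MS -> a *m X^T = 0.
  by move=> /submxP[D ->]; rewrite trmx_mul mulmxA aS mul0mx.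
have an : a *m (stack n)^T = 0.
  by apply: a_perp; have [J ->] := stack_sub v n_le; apply: submxMl.
have dot_a (x : 'rV_d) : (x <= stack k)%MS -> dot x a = 0.
  move=> /a_perp; rewrite dotE dotC => /matrixP/(_ 0 0).
  by rewrite !mxE eqxx mulr1n.
have ba := dot_a _ bS.
have va : dot (v n) a = 0.
  apply: dot_a; have [J JE] := stack_sub v n_lt.
  have vS : (v n <= col_mx (v n) (stack n))%MS by rewrite -addsmxE addsmxSl.
  have : (stack n.+1 <= stack k)%MS by rewrite JE submxMl.
  exact: submx_trans vS.
set beta := dot b b; set alpha := dot a a in aa.
pose E := affine (stack n) t.
have vE : v n \in E by rewrite inE.
pose sol y := [set lm : F * F | y + (lm.1 *: b + lm.2 *: a) \in fibre (stack n)].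
have EW (lm : F * F) : lm.1 *: b + lm.2 *: a \in affine (stack n) 0.
  by rewrite inE mulmxDl -!scalemxAl bn an !scaler0 addr0.
have solE y : y \in E -> sol y = [set lm | dot y y + 2%:R * (lm.1 * dot y b) +
    2%:R * (lm.2 * dot y a) + lm.1 ^+ 2 * beta + lm.2 ^+ 2 * alpha == t0].
  move=> yE; apply/setP => lm; rewrite !inE -/t.
  have -> : (y + (lm.1 *: b + lm.2 *: a)) *m (stack n)^T == t.
    by have := mem_affineD (lm.1 *: b + lm.2 *: a) yE; rewrite EW inE.
  rewrite /= !dot_linear [dot b y]dotC [dot a y]dotC [dot a b]dotC ba -/beta -/alpha -/t0.
  by congr (_ == _); ring.
(* Each point of the fibre lies in [q ^ 2] of the parametrized planes. *)
have total : (\sum_(y in E) #|sol y| = q ^ 2 * #|fibre (stack n)|)%N.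
  under eq_bigr do rewrite -sum1dep_card.
  rewrite (exchange_big_dep xpredT) //=.
  transitivity (\sum_(lm : F * F) #|fibre (stack n)|)%N.
    apply: eq_bigr => lm _; rewrite sum1dep_card.
    have h_inj := addIr (lm.1 *: b + lm.2 *: a).
    rewrite -(card_imset _ h_inj); apply: eq_card => x.
    apply/imsetP/idP => [[y]|xfib].
      by rewrite inE => /andP[_ yfib] ->.
    exists (x - (lm.1 *: b + lm.2 *: a)); rewrite ?subrK // inE subrK xfib andbT.
    have := EW lm; move: xfib; rewrite !inE => /andP[/eqP xE _] /eqP wE.
    by rewrite mulmxBl xE wE subr0.
  by rewrite sum_nat_const card_prod mulnn.
suff [psi [deg_psi psi_v psi_sol]] : exists psi : 'rV_d -> F,
    [/\ degree_le (stack n) 2 psi, psi (v n) != 0 &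
        forall y, y \in E -> psi y != 0 -> (q <= #|sol y| + 1)%N].
  have nz := card_degree_le_nonzeros deg_psi vE psi_v.
  rewrite card_affine0 (eqP free_n) in nz.
  have : (#|[set y in E | psi y != 0%R]| * q.-1 <= q ^ 2 * #|fibre (stack n)|)%N.
    rewrite -total -sum_nat_const big_mkcond [X in (_ <= X)%N]big_mkcond /=.
    apply: leq_sum => y _; rewrite [y \in [set _ in _ | _]]inE; case: ifP => // /andP[yE psi_y].
    by rewrite yE -subn1 leq_subLR addnC psi_sol.
  move: nz; rewrite (_ : (d - n = (d - n.+1).+1)%N); last by lia.
  rewrite expnS; move: q q_gt2 (q ^ (d - n.+1))%N (#|[set y in E | _]|) (#|fibre _|).
  move=> q' q'_gt2 Q N f le1 le2.
  have : (q'.-1 * Q * q' <= 4 * f * q' * q')%N by nia.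
  rewrite leq_mul2r; case: eqP => [|_ /= le3]; first by lia.
  have : (2 * q' * Q <= 12 * f * q')%N by nia.
  by rewrite mulnAC leq_mul2r; case: eqP => [|_ /=]; lia.
(* If [b] is isotropic, the equation of the conic is linear in the first
   parameter, with coefficient [2 * dot y b]; otherwise completing squares gives
   a central conic with right side [psi y]. *)
have [beta0|beta0] := eqVneq beta 0.
  exists (fun y => dot y b); split; first by move=> w _ w' _ y w'' _; rewrite !dot_linear; ring.
    by rewrite dotC bv oner_neq0.
  move=> y yE yb; rewrite solE //; apply: leq_trans (leq_addr _ _).
  pose h m : F * F :=
    ((t0 - dot y y - 2%:R * (m * dot y a) - m ^+ 2 * alpha) / (2%:R * dot y b), m).
  have h_inj : injective h by move=> m m' [].
  rewrite -cardsT -(card_imset _ h_inj); apply/subset_leq_card/subsetP => lm.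
  move=> /imsetP[m _ ->]; rewrite inE beta0 /h /=; apply/eqP.
  by field; rewrite F2 yb.
exists (fun y => t0 - dot y y + dot y a ^+ 2 / alpha + dot y b ^+ 2 / beta); split.
- move=> w _ w' _ y w'' _ /=; rewrite !dot_linear [dot w y]dotC [dot w' y]dotC [dot w'' y]dotC.
  rewrite [dot w' w]dotC [dot w'' w]dotC [dot w'' w']dotC; ring.
- by rewrite -/t0 subrr va dotC bv expr0n mul0r !add0r expr1n mulf_neq0 ?oner_neq0 ?invr_neq0.
move=> y yE psi_y; apply: leq_trans (card_conic F2 aa beta0 psi_y) _.
rewrite leq_add2r solE //.
pose h (z : F * F) : F * F := (z.1 - dot y b / beta, z.2 - dot y a / alpha).
have h_inj : injective h by move=> [x z] [x' z'] [/addIr-> /addIr->].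
rewrite -(card_imset _ h_inj); apply/subset_leq_card/subsetP => lm.
move=> /imsetP[[x z]]; rewrite inE /= => /eqP conic ->; rewrite inE /h /=; apply/eqP.
rewrite -[RHS](subrK (beta * x ^+ 2 + alpha * z ^+ 2)) {1}conic.
by field; rewrite beta0 aa.
Qed.

End FibreLower.

(** * The second moment *)

Section SecondMoment.
Variables (F : finFieldType) (d k : nat) (v : nat -> 'rV[F]_d).
Hypothesis F2 : 2%:R != 0 :> F.
Hypothesis k_lt_d : (k < d)%N.
Hypothesis gram_unit : gram (stack v k) \in unitmx.
Variable e : addchar F.
Local Notation q := #|F|.
Local Notation copies := (copies v).
Local Notation fibre := (fibre v).
Local Notation stack := (stack v).

Let q_gt0 : (0 < q)%N. Proof. exact: ltnW (finNzRing_gt1 F). Qed.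

(** The vectors [v n + c *m stack n] are not all isotropic, as otherwise [v n]
    would be orthogonal to itself and to the other vectors. *)
Lemma card_face_norm_zeros n : n.+1 = k ->
  (q * #|[set c : 'rV_n | face_norm v c == 0%R]| <= 3 * q ^ n)%N.
Proof.
move=> nk; pose Z : 'M[F]_(0, n) := 0.
have inZ (c : 'rV[F]_n) : c \in affine Z 0.
  by rewrite inE; apply/eqP/rowP => -[].
have cardZ : #|affine Z 0| = (q ^ n)%N.
  by rewrite card_affine0 mxrank0 subn0.
have [c0 c0n] : exists c0 : 'rV_n, face_norm v c0 != 0.
  apply/existsP; move: gram_unit; apply: contraLR => /existsPn h.
  have iso (c : 'rV_n) : face_norm v c = 0 by apply/eqP; rewrite -[_ == _]negbK h.
  have vv : dot (v n) (v n) = 0 by have := iso 0; rewrite /face_norm mul0mx addr0.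
  have vc (c : 'rV_n) : dot (v n) (c *m stack n) = 0.
    have : 2%:R * (2%:R * dot (v n) (c *m stack n)) = face_norm v c - face_norm v (- c).
      by rewrite /face_norm mulNmx !dot_linear [dot (c *m _) (v n)]dotC; ring.
    rewrite !iso subrr.
    by move/eqP; rewrite !mulf_eq0 (negPf F2) /= => /eqP.
  have vS : v n *m (stack n)^T = 0.
    apply/rowP => j; rewrite mulmx_dot mxE rowE.
    exact: vc.
  apply/negP => gram_u.
  pose r : 'rV[F]_(1 + n) := row_mx 1%:M 0.
  have r0 : r *m gram (col_mx (v n) (stack n)) = 0.
    rewrite /gram mulmxA mul_row_col mul1mx mul0mx addr0 tr_col_mx mul_mx_row.
    by rewrite dotE vv vS raddf0 row_mx0.
  have : r = 0.
    move: gram_u; rewrite -nk -[stack n.+1]/(col_mx (v n) (stack n)) => gram_u.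
    by apply: (row_free_inj (_ : row_free (gram (col_mx (v n) (stack n)))));
      rewrite ?row_free_unit // r0 mul0mx.
  move/(congr1 lsubmx)/matrixP/(_ 0 0)/eqP.
  by rewrite row_mxKl linear0 !mxE oner_eq0.
have := card_quadratic_zeros F2 (inZ c0) c0n; rewrite cardZ.
have -> : [set y in affine Z 0 | face_norm v y == 0%R] = [set c | face_norm v c == 0%R].
  by apply/setP => c; rewrite in_set inZ in_set.
apply=> u _; exists (2%:R * dot (v n + c0 *m stack n) (u *m stack n)).
exists (dot (u *m stack n) (u *m stack n)) => l.
rewrite /face_norm mulmxDl -scalemxAl addrA.
move: (v n + c0 *m stack n) (u *m stack n) => x w.
by rewrite !dot_linear [dot w x]dotC; ring.
Qed.

(** At the last step, [n.+1 = k], the square root bound holds outside a quadric,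
    and the trivial bound on the quadric costs nothing as the quadric has density
    at most [3 / q]. At an earlier step the trivial bound loses one factor [q],
    which [k - n.+1 > 0] allows. *)
Lemma sum_fibre_kernel n b : (n < k)%N ->
  \sum_c `|fibre_kernel v e b (c : 'rV_n)| ^+ 2
    <= (7 * (q ^ (2 * n.+1) * q ^ (d - n.+1 + (k - n.+1))))%:R.
Proof.
move=> n_lt; have [nk|nk] := eqVneq n.+1 k.
  have Zn := card_face_norm_zeros nk; set N := #|_| in Zn.
  apply: (@le_trans _ _ (q ^ n * (4 * q ^ d.+1) + N * q ^ d.+2)%:R).
    have -> : (q ^ n * (4 * q ^ d.+1) + N * q ^ d.+2)%:R =
        \sum_(c : 'rV[F]_n) (4 * q ^ d.+1)%:R +
        \sum_(c in [set c : 'rV_n | face_norm v c == 0]) (q ^ d.+2)%:R :> algC.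
      by rewrite !sumr_const card_rV -/N -!mulrnA -natrD [(_ * N)%N]mulnC [(4 * _ * _)%N]mulnC.
    rewrite [X in _ + X]big_mkcond -big_split /=; apply: ler_sum => c _; rewrite inE.
    case: eqVneq => [c0|c0]; last first.
      by rewrite addr0 natrM natrX twisted_sum_norm.
    apply: le_trans (twisted_sum_norm_triv _ F2 _ _ _) _.
    by rewrite natrX lerDr ler0n.
  rewrite ler_nat nk subnn addn0 -nk -expnD.
  have -> : (2 * n.+1 + (d - n.+1) = n + d.+1)%N by lia.
  rewrite expnD; move: Zn; rewrite (expnS _ d.+1).
  by move: (q ^ n)%N (q ^ d.+1)%N => x y; nia.
apply: (@le_trans _ _ (q ^ n * q ^ d.+2)%:R).
  rewrite natrM -card_rV -[#|_|%:R]/(_ *+ _) mulr_natl -sumr_const.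
  by apply: ler_sum => c _; rewrite natrX twisted_sum_norm_triv.
rewrite ler_nat -!expnD; apply: leq_trans (leq_pmull _ _) => //.
by rewrite leq_pexp2l //; lia.
Qed.

(** The copies whose span contains [xi] are rare enough for the trivial bound of
    their character sums. For the others the sum depends only on the products of
    [xi] with the copy, and no value of these is taken more often than a
    constant times the average. *)
Lemma second_moment n (xi : 'rV_d) : (n < k)%N -> xi != 0 ->
  \sum_(Y in copies n) `|fibre_sum v e Y xi| ^+ 2
    <= (16 * (3 ^ n * volume F d n * q ^ (d - n.+1 + (k - n.+1))))%:R.
Proof.
move=> n_lt xi0; set E := (d - n.+1 + (k - n.+1))%N.
rewrite (bigID (fun Y => (xi <= Y)%MS)) /= (_ : 16 = 9 + 7)%N // mulnDl natrD.
apply: lerD.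
  apply: (@le_trans _ _ (\sum_(Y in [set Y in copies n | (xi <= Y)%MS])
      ((3 * q ^ (d - n.+1)) ^ 2)%:R)).
    rewrite [leRHS](eq_bigl (fun Y => (Y \in copies n) && (xi <= Y)%MS)); last first.
      by move=> Y; rewrite in_set.
    apply: ler_sum => Y /andP[Ycop _]; rewrite natrX ler_sqr ?nnegrE ?ler0n //.
    apply: le_trans (ler_norm_sum _ _ _) _.
    under eq_bigr do rewrite addchar_norm.
    by rewrite sumr_const ler_nat (card_fibre_le F2 k_lt_d gram_unit).
  rewrite sumr_const -mulrnA ler_nat.
  have := card_span_le F2 k_lt_d gram_unit (ltnW n_lt) xi0.
  have : (q ^ (d - n.+1) <= q ^ E)%N by rewrite leq_pexp2l // leq_addr.
  move: (#|_|) (q ^ (d - n.+1))%N (q ^ E)%N (3 ^ n * _)%N => P Q Q' V QQ' PQ.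
  have -> : ((3 * Q) ^ 2 * P = 9 * (P * Q * Q))%N by ring.
  by rewrite leq_mul2l leq_mul.
have slice_le eta := card_slice_le F2 k_lt_d gram_unit xi eta (ltnW n_lt).
pose kap := fibre_kernel v e (n := n) (dot xi xi / 4%:R).
have q1_gt0 : 0 < (q ^ (2 * n.+1))%:R :> algC by rewrite ltr0n expn_gt0 q_gt0.
rewrite -(ler_pM2l q1_gt0) mulr_sumr.
apply: (@le_trans _ _ (\sum_eta `|fourier e kap (- eta)| ^+ 2 * (3 ^ n * slice_volume F d n)%:R)).
  rewrite (partition_big (fun Y => xi *m Y^T) xpredT) //=.
  apply: ler_sum => eta _.
  rewrite (eq_bigr (fun=> `|fourier e kap (- eta)| ^+ 2)).
    rewrite sumr_const -[leLHS]mulr_natr ler_wpM2l ?exprn_ge0 // ler_nat.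
    apply: leq_trans (slice_le eta); apply/subset_leq_card/subsetP => Y.
    by move=> /andP[/andP[Yc xiY] etaE]; rewrite in_set Yc xiY etaE.
  move=> Y /andP[/andP[Ycop xiY] /eqP <-].
  have := fibre_sumE F2 e Ycop (_ : (xi == 0) || ~~ (xi <= Y)%MS).
  rewrite xiY orbT (negPf xi0) mulr0 add0r => /(_ isT) <-.
  by rewrite normrM exprMn normrX normr_nat natrX mulnC exprM.
rewrite -mulr_suml.
have -> : \sum_eta `|fourier e kap (- eta)| ^+ 2 = \sum_eta `|fourier e kap eta| ^+ 2.
  by rewrite [RHS](reindex_inj oppr_inj).
rewrite parseval -/kap.
have kap_le := sum_fibre_kernel (dot xi xi / 4%:R) n_lt; rewrite -/kap -/E in kap_le.
rewrite mulrAC; apply: le_trans (ler_wpM2l _ kap_le) _.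
  by rewrite -natrX -natrM ler0n.
rewrite -natrX -!natrM ler_nat -(volume_slice F (ltn_trans n_lt k_lt_d)).
by apply: eq_leq; ring.
Qed.

End SecondMoment.

(** * Placing one more vector *)

Lemma sum_norm_sqr_le (I : finType) (S : {set I}) (f : I -> algC) :
  `|\sum_(i in S) f i| ^+ 2 <= #|S|%:R * \sum_(i in S) `|f i| ^+ 2.
Proof.
set g := fun i => `|f i|; set s1 := \sum_(i in S) g i; set s2 := \sum_(i in S) g i ^+ 2.
have s1_ge0 : 0 <= s1 by apply: sumr_ge0 => i _; apply: normr_ge0.
apply: (@le_trans _ _ (s1 ^+ 2)).
  by rewrite ler_sqr ?nnegrE // ler_norm_sum.
have : 0 <= \sum_(i in S) \sum_(j in S) (g i - g j) ^+ 2.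
  apply: sumr_ge0 => i _; apply: sumr_ge0 => j _.
  by rewrite real_exprn_even_ge0 // rpredB ?normr_real.
have -> : \sum_(i in S) \sum_(j in S) (g i - g j) ^+ 2 =
    2%:R * (#|S|%:R * s2 - s1 ^+ 2).
  transitivity (\sum_(i in S) (g i ^+ 2 *+ #|S| - 2%:R * (g i * s1) + s2)).
    apply: eq_bigr => i _; rewrite -sumr_const mulr_sumr mulr_sumr -sumrB -big_split /=.
    by apply: eq_bigr => j _; ring.
  rewrite big_split /= sumrB sumrMnl sumr_const -mulr_sumr -mulr_suml.
  by rewrite -/s1 -/s2 -[s2 *+ _]mulr_natl; ring.
by rewrite pmulr_rge0 ?ltr0n // subr_ge0.
Qed.

Section CountingStep.
Variables (F : finFieldType) (d k : nat) (v : nat -> 'rV[F]_d).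
Hypothesis F2 : 2%:R != 0 :> F.
Hypothesis k_lt_d : (k < d)%N.
Hypothesis gram_unit : gram (stack v k) \in unitmx.
Variable A : {set 'rV[F]_d}.
Local Notation q := #|F|.
Local Notation copies := (copies v).
Local Notation fibre := (fibre v).
Local Notation stack := (stack v).

Definition placed n : {set 'rV[F]_d * 'M[F]_(n, d)} :=
  [set z | [&& z.2 \in copies n, z.1 \in A & [forall j, z.1 + row j z.2 \in A]]].

Definition placed_fibre n (z : 'rV[F]_d * 'M[F]_(n, d)) : {set 'rV_d} :=
  [set y in fibre z.2 | z.1 + y \in A].

Lemma card_placed0 : #|placed 0| = #|A|.
Proof.
have h_inj : injective (fun x : 'rV[F]_d => (x, 0 : 'M[F]_(0, d))) by move=> x y [].
rewrite -[RHS](card_imset _ h_inj); apply: eq_card => -[x Y].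
rewrite (flatmx0 Y) inE /=; apply/idP/imsetP => [/and3P[_ xA _]|[y yA [->]]].
  by exists x.
by rewrite yA (stack_copies gram_unit) //=; apply/forallP => -[].
Qed.

(** The coefficients of such a dependence form, with [- 1], a vector in the kernel
    of the Gram matrix of [n.+1] vectors. *)
Lemma card_fibre_dependent n (Y : 'M_(n, d)) : (n < k)%N -> Y \in copies n ->
  (#|[set y in fibre Y | (y <= Y)%MS]| <= q ^ (k - n.+1))%N.
Proof.
move=> n_lt Ycop; set G := gram (stack n.+1).
pose h (y : 'rV[F]_d) : 'rV[F]_(1 + n) := row_mx (- 1%:M) (y *m pinvmx Y).
have kerE : #|affine G^T 0| = (q ^ (n.+1 - \rank G))%N by rewrite card_affine0 mxrank_tr.
apply: (@leq_trans #|affine G^T 0|); last first.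
  rewrite kerE leq_pexp2l ?(ltnW (finNzRing_gt1 F)) //.
  by have := rank_gram_stack gram_unit n_lt; rewrite -/G; lia.
set S := [set y in _ | _].
have h_inj : {in S &, injective h}.
  move=> y y'; rewrite !in_set => /andP[_ yY] /andP[_ yY'] /eq_row_mx[_ eqc].
  by rewrite -(mulmxKpV yY) -(mulmxKpV yY') eqc.
rewrite -(card_in_imset h_inj); apply/subset_leq_card/subsetP => r /imsetP[y].
rewrite in_set => /andP[yfib yY] ->; rewrite inE trmxK.
have yE : y *m pinvmx Y *m Y = y := mulmxKpV yY.
move: yfib Ycop; rewrite !inE => /andP[/eqP yt /eqP yy] /andP[free_Y /eqP gramY].
have GE : G = gram (col_mx y Y).
  by apply/eqP; rewrite eq_sym gram_col_mx gramY eqxx yt yy !eqxx.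
have hE : h y *m col_mx y Y = 0 by rewrite /h mul_row_col yE mulNmx mul1mx addNr.
by rewrite GE /gram (mulmxA (h y)) hE mul0mx.
Qed.

Lemma mem_placed_col_mx n (x y : 'rV[F]_d) (Y : 'M[F]_(n, d)) :
  ((x, col_mx y Y : 'M_(n.+1, d)) \in placed n.+1) =
  ((x, Y) \in placed n) && (y \in placed_fibre (x, Y)) && ~~ (y <= Y)%MS.
Proof.
have rows : [forall j : 'I_(1 + n), x + row j (col_mx y Y) \in A] =
    (x + y \in A) && [forall j, x + row j Y \in A].
  apply/forallP/andP => [h|[xyA /forallP h] j].
    split; first by have := h (lshift n (0 : 'I_1)); rewrite rowKu row_id.
    by apply/forallP => j; have := h (rshift 1 j); rewrite rowKd.
  by case: (split_ordP j) => i ->; rewrite ?rowKu ?rowKd ?h // ord1 row_id.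
rewrite in_set [(x, Y) \in _]in_set [y \in placed_fibre _]in_set /= copies_col_mx.
move: rows => /= ->.
case: (Y \in _) => //=; case: (x \in A); rewrite ?andbF //=.
case: (y \in _) => //=; rewrite ?andbF //; case: (_ \in A); rewrite ?andbF //=.
by rewrite andbT andbC.
Qed.

Lemma card_placedS n : (n < k)%N ->
  (\sum_(z in placed n) #|placed_fibre z| <= #|placed n.+1| + #|placed n| * q ^ (k - n.+1))%N.
Proof.
move=> n_lt.
pose S (z : 'rV[F]_d * 'M[F]_(n, d)) := [set y in placed_fibre z | ~~ (y <= z.2)%MS].
have -> : #|placed n.+1| = (\sum_(z in placed n) #|S z|)%N.
  have fubini m (f : 'rV[F]_d * 'M[F]_(m, d) -> nat) :
      (\sum_z f z = \sum_x \sum_Y f (x, Y))%N.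
    by rewrite pair_bigA; apply: eq_bigr => -[].
  rewrite -sum1_card big_mkcond [RHS]big_mkcond !fubini.
  apply: eq_bigr => x _; rewrite -big_mkcond sum1dep_card.
  rewrite (card_col_mx (fun X : 'M_(1 + n, d) => (x, X : 'M_(n.+1, d)) \in placed n.+1)).
  apply: eq_bigr => Y _; case: ifP => xYP.
    by apply: eq_card => y; rewrite [LHS]in_set mem_placed_col_mx xYP [RHS]in_set.
  by apply/eqP; rewrite cards_eq0; apply/eqP/setP => y;
    rewrite in_set mem_placed_col_mx xYP in_set0.
rewrite -sum_nat_const -big_split /=; apply: leq_sum => z zP.
have Ycop : z.2 \in copies n by move: zP; rewrite in_set => /and3P[].
rewrite -(cardsID [set y | (y <= z.2)%MS] (placed_fibre z)) addnC leq_add //.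
  by apply/subset_leq_card/subsetP => y; rewrite !in_set => /andP[-> ->].
apply: leq_trans (card_fibre_dependent n_lt Ycop).
apply/subset_leq_card/subsetP => y; rewrite in_setI => /andP[].
rewrite [y \in placed_fibre z]in_set => /andP[yfib _].
by rewrite in_set => yY; rewrite in_set yfib.
Qed.

(** The difference is the sum over the placed copies of the sum over the fibre of
    a function [f] with mean zero. After the Cauchy-Schwarz inequality one may
    sum over all positions of all copies; by Parseval only the frequencies
    [xi != 0] contribute, and [second_moment] bounds the sum over the copies. *)
Lemma placed_discrepancy n : (n < k)%N ->
  `|(q ^ d * \sum_(z in placed n) #|placed_fibre z|)%:R -
    (#|A| * #|fibre (stack n)| * #|placed n|)%:R : algC| ^+ 2 <=
  (#|placed n| * (16 * (3 ^ n * volume F d n * q ^ (d - n.+1 + (k - n.+1)))) *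
     (q ^ d * q ^ d * #|A|))%:R.
Proof.
move=> n_lt; have [e] := addchar_exists F.
set B := (16 * _)%N.
pose f x : algC := (q ^ d)%:R * (x \in A)%:R - #|A|%:R.
pose g (Y : 'M_(n, d)) x := \sum_(y in fibre Y) f (x + y).
have -> : (q ^ d * \sum_(z in placed n) #|placed_fibre z|)%:R -
    (#|A| * #|fibre (stack n)| * #|placed n|)%:R = \sum_(z in placed n) g z.2 z.1.
  transitivity (\sum_(z in placed n)
      ((q ^ d)%:R * #|placed_fibre z|%:R - (#|A| * #|fibre (stack n)|)%:R : algC)).
    rewrite sumrB sumr_const -mulr_sumr -natr_sum -mulrnA natrM; congr (_ - _).
  apply: eq_bigr => z zP; have Ycop : z.2 \in copies n by move: zP; rewrite in_set => /and3P[].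
  rewrite /g sumrB sumr_const -mulr_sumr -natr_sum -mulrnA.
  rewrite -(card_fibre_const F2 e Ycop (stack_copies gram_unit (ltnW n_lt))).
  congr (_ * _%:R - _); rewrite -sum1_card [LHS]big_mkcond [RHS]big_mkcond.
  by apply: eq_bigr => y _; rewrite in_set; case: (y \in _); case: (_ \in A).
apply: le_trans (sum_norm_sqr_le _ _) _.
rewrite -mulnA natrM ler_wpM2l ?ler0n //.
have f_l2 : \sum_x `|f x| ^+ 2 <= (q ^ d * q ^ d * #|A|)%:R.
  have f2 x : `|f x| ^+ 2 = ((q ^ d)%:R * (q ^ d)%:R - 2%:R * (q ^ d)%:R * #|A|%:R) *
      (x \in A)%:R + #|A|%:R ^+ 2.
    rewrite real_normK; last by rewrite rpredB ?rpredM ?realn.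
    by rewrite /f; case: (x \in A); rewrite ?mulr1n ?mulr0n; ring.
  under eq_bigr do rewrite f2.
  rewrite big_split -mulr_sumr -natr_sum -big_mkcond sum1_card sumr_const card_rV /=.
  rewrite !natrM -[#|A|%:R ^+ 2 *+ _]mulr_natr -subr_ge0.
  set Q := (q ^ d)%:R; have -> : Q * Q * #|A|%:R - ((Q * Q - 2 * Q * #|A|%:R) * #|A|%:R +
      #|A|%:R ^+ 2 * Q) = Q * #|A|%:R ^+ 2 by ring.
  by rewrite -natrX -natrM ler0n.
have f_hat0 : fourier e f 0 = 0.
  rewrite /fourier; under eq_bigr do rewrite dot0r addchar0 mulr1.
  rewrite sumrB -mulr_sumr -natr_sum -big_mkcond sum1_card sumr_const card_rV.
  by rewrite -[X in _ - X]mulr_natl subrr.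
have g_hat Y xi : fourier e (g Y) xi = fourier e f xi * (fibre_sum v e Y xi)^*.
  rewrite /fourier /g /fibre_sum rmorph_sum mulr_sumr.
  under eq_bigr do rewrite mulr_suml.
  rewrite exchange_big; apply: eq_bigr => y _ /=.
  rewrite (reindex_inj (addIr (- y))) mulr_suml /=; apply: eq_bigr => x _.
  by rewrite subrK dotDl dotNl addcharD addcharN mulrA.
have qd_gt0 : 0 < (q%:R : algC) ^+ d.
  by rewrite exprn_gt0 // ltr0n (ltnW (finNzRing_gt1 F)).
apply: (@le_trans _ _ (\sum_(Y in copies n) \sum_x `|g Y x| ^+ 2)).
  rewrite exchange_big pair_big_dep /= big_mkcond [leRHS]big_mkcond /=.
  apply: ler_sum => z _; rewrite in_set; case: (z.2 \in copies n) => //=.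
  by case: ifP => // _; apply: exprn_ge0.
rewrite -(ler_pM2l qd_gt0) mulr_sumr.
under eq_bigr do rewrite -(parseval e).
rewrite exchange_big /=; apply: (@le_trans _ _ (\sum_xi `|fourier e f xi| ^+ 2 * B%:R)).
  apply: ler_sum => xi _; have [->|xi0] := eqVneq xi 0.
    rewrite f_hat0 normr0 expr0n mul0r big1 // => Y _.
    by rewrite g_hat f_hat0 mul0r normr0 expr0n.
  under eq_bigr do rewrite g_hat normrM norm_conjC exprMn.
  by rewrite -mulr_sumr ler_wpM2l ?exprn_ge0 // second_moment.
rewrite -mulr_suml parseval -mulrA ler_wpM2l ?(ltW qd_gt0) // mulrC natrM.
by rewrite ler_wpM2l ?ler0n.
Qed.

(** The hypothesis makes the discrepancy at most half of the main term. The
    constant is [4 * 16 * 6 ^ 2], with [16] from [second_moment] and [6] from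
    [card_fibre_ge]. *)
Lemma placed_step n : (n < k)%N ->
    (2304 * 3 ^ n * volume F d n * q ^ (k - n.+1) * (q ^ d * q ^ d)
       <= #|A| * q ^ (d - n.+1) * #|placed n|)%N ->
  (#|A| * q ^ (d - n.+1) * #|placed n|
     <= 12 * q ^ d * (#|placed n.+1| + #|placed n| * q ^ (k - n.+1)))%N.
Proof.
move=> n_lt big; have := placed_discrepancy n_lt; have := card_placedS n_lt.
have := card_fibre_ge F2 k_lt_d gram_unit n_lt (stack_copies gram_unit (ltnW n_lt)).
rewrite expnD; move: big.
move: (q ^ (d - n.+1))%N (q ^ (k - n.+1))%N (q ^ d)%N (3 ^ n)%N => Q K D T.
move: (volume F d n) #|A| #|placed n| #|placed n.+1| #|fibre (stack n)| => V a N N' phi.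
move: (\sum_(z in _) _)%N => S big Q_le S_le disc.
(* Otherwise the discrepancy would exceed half of the main term [X]. *)
have X_le : (a * phi * N <= 2 * (D * S))%N.
  rewrite leqNgt; apply/negP => lt_X; set X := (a * phi * N)%N in disc lt_X.
  set H := (D * S)%N in disc lt_X.
  have disc' : ((X - H) ^ 2 <= N * (16 * (T * V * (Q * K))) * (D * D * a))%N.
    rewrite -(ler_nat algC) natrX natrB; last by lia.
    by rewrite -real_normK ?rpredB ?realn // distrC.
  have : (36 * (4 * (N * (16 * (T * V * (Q * K))) * (D * D * a))) <= 36 * X ^ 2)%N.
    apply: (@leq_trans ((a * N * Q) * (a * Q * N))).
      apply: (@leq_trans ((a * N * Q) * (2304 * T * V * K * (D * D)))).
        by apply: eq_leq; ring.
      by rewrite leq_mul2l big orbT.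
    have : ((a * N * Q) * (a * N * Q) <= (a * N * (6 * phi)) * (a * N * (6 * phi)))%N.
      by rewrite leq_mul // leq_mul2l Q_le orbT.
    by rewrite /X (mulnAC a Q N) => /leq_trans; apply; apply: eq_leq; ring.
  rewrite leq_mul2l /= => le4.
  have : (4 * (X - H) ^ 2 <= X ^ 2)%N by apply: leq_trans le4; rewrite leq_mul2l.
  have : (X < 2 * (X - H))%N by lia.
  by move: (X - H)%N => W; rewrite -!mulnn => ? ?; nia.
apply: (@leq_trans (6 * (a * phi * N))).
  have : (a * N * Q <= a * N * (6 * phi))%N by rewrite leq_mul2l Q_le orbT.
  by rewrite (mulnAC a Q N) => /leq_trans; apply; apply: eq_leq; ring.
apply: (@leq_trans (12 * D * S)); first by move: X_le; rewrite -mulnA; lia.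
by rewrite leq_mul2l S_le orbT.
Qed.

End CountingStep.

(** * From matrices to simplices *)

Section SimplexMatrix.
Variables (F : finFieldType) (d k : nat) (w : 'I_k.+2 -> 'rV[F]_d).

(** Listed backwards, as [stack] puts later vectors on top. *)
Definition edge_seq (m : nat) : 'rV[F]_d := edge w (inord (k - m)).

Lemma row_stack (v : nat -> 'rV[F]_d) n (j : 'I_n) : row j (stack v n) = v (n - j.+1)%N.
Proof.
elim: n j => [|n IH] j; first by case: j.
suff h (l : 'I_(1 + n)) : row l (col_mx (v n) (stack v n)) = v (n.+1 - l.+1)%N by exact: h.
case: (split_ordP l) => i ->; first by rewrite rowKu ord1 row_id /= subn1.
by rewrite rowKd IH.
Qed.

Lemma row_edge_stack (j : 'I_k.+1) : row j (stack edge_seq k.+1) = edge w j.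
Proof.
rewrite row_stack /edge_seq; congr edge; apply: val_inj; rewrite /= inordK.
  by have := ltn_ord j; lia.
by have := ltn_ord j; lia.
Qed.

Lemma row_free_edges (Y : 'M[F]_(k.+1, d)) (y : 'I_k.+2 -> 'rV[F]_d) :
  (forall j, row j Y = edge y j) -> row_free Y = free (edges y).
Proof.
move=> rowY.
have sumE (c : 'I_k.+1 -> F) :
    \sum_(i < k.+1) c i *: (edges y)`_i = (\row_i c i) *m Y.
  rewrite mulmx_sum_row; apply: eq_bigr => i _.
  by rewrite mxE -tnth_nth tnth_mktuple rowY.
apply/idP/freeP => [free_Y c|free_y].
  rewrite sumE => cY i; have : \row_i c i = 0 by apply: (row_free_inj free_Y); rewrite cY mul0mx.
  by move/rowP/(_ i); rewrite !mxE.
apply: inj_row_free => c cY; apply/rowP => i; rewrite mxE.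
apply: (free_y (fun i => c 0 i)); rewrite sumE -[RHS]cY; congr (_ *m _).
by apply/rowP => j; rewrite mxE.
Qed.

Lemma gram_edges_unit (S : {set 'rV[F]_d}) : is_simplex k.+1 S -> orders w S ->
  simplex_rank w = k.+1 -> gram (stack edge_seq k.+1) \in unitmx.
Proof.
move=> [w' w'S free_w'] wS rank_w.
have free_w : free (edges w).
  by move: free_w'; rewrite /free !size_tuple (span_edges_orders w'S wS).
have free_V : row_free (stack edge_seq k.+1).
  by rewrite (row_free_edges row_edge_stack).
rewrite -row_free_unit; apply: inj_row_free => c cG.
set x := c *m stack edge_seq k.+1.
suff x0 : x = 0 by apply: (row_free_inj free_V); rewrite -/x x0 mul0mx.
have xV : x \in <<edges w>>%VS.
  rewrite /x mulmx_sum_row; apply: memv_suml => i _; apply: memvZ.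
  rewrite row_edge_stack; apply: memv_span; apply/mapP; exists i => //.
  exact: mem_enum.
have x_perp : x \in Defs.orthov <<edges w>>%VS.
  apply/mem_orthov => u uV; rewrite (coord_span uV).
  rewrite dotC (big_morph (dot x) (fun u v => dotDr u v x) (dot0r x)) big1 // => i _.
  rewrite dotZr -tnth_nth tnth_mktuple -row_edge_stack.
  by rewrite -mulmx_dot /x -mulmxA -/(gram _) cG mxE mulr0.
have cap0 : (<<edges w>> :&: Defs.orthov <<edges w>>)%VS = 0%VS.
  by apply/eqP; rewrite -dimv_eq0; move: rank_w; rewrite /simplex_rank; lia.
have : x \in (<<edges w>> :&: Defs.orthov <<edges w>>)%VS by rewrite memv_cap xV.
by rewrite cap0 memv0 => /eqP.
Qed.

End SimplexMatrix.

Lemma placed_simplex (F : finFieldType) (d k : nat) (w : 'I_k.+2 -> 'rV[F]_d)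
    (A D : {set 'rV[F]_d}) z :
    z \in placed (edge_seq w) A k.+1 -> orders w D ->
  exists D' : {set 'rV[F]_d},
    [/\ is_simplex k.+1 D', D' \subset A & isometric k.+1 D' D].
Proof.
case: z => x Y; rewrite in_set /= => /and3P[Ycop xA /forallP rowA] wD.
pose y (i : 'I_k.+2) := if unlift ord0 i is Some j then x + row j Y else x.
have y0 : y ord0 = x by rewrite /y unlift_none.
have yl j : y (lift ord0 j) = x + row j Y by rewrite /y liftK.
have edge_y j : row j Y = edge y j by rewrite /edge yl y0 addrC addKr.
have free_Y : row_free Y by move: Ycop; rewrite in_set => /andP[].
have delta_inj (r s : 'rV[F]_k.+1) : r *m Y = s *m Y -> r = s by apply: row_free_inj.
have row_neq0 j : row j Y != 0.
  apply/eqP; rewrite rowE -[RHS](mul0mx _ Y) => /delta_inj/matrixP/(_ 0 j)/eqP.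
  by rewrite !mxE !eqxx oner_eq0.
have y_inj : injective y.
  move=> i i'; case: (unliftP ord0 i) => [j ->|->]; case: (unliftP ord0 i') => [j' ->|->] //;
    rewrite ?yl ?y0.
  - move=> /addrI; rewrite !rowE => /delta_inj/matrixP/(_ 0 j)/eqP.
    by rewrite !mxE !eqxx /=; case: (eqVneq j j') => [->//|_]; rewrite oner_eq0.
  - by move/eqP; rewrite -subr_eq0 addrAC subrr add0r (negPf (row_neq0 j)).
  - by move/esym/eqP; rewrite -subr_eq0 addrAC subrr add0r (negPf (row_neq0 j')).
exists [set y i | i : 'I_k.+2]; split.
- by exists y => //; rewrite -(row_free_edges edge_y).
- apply/subsetP => _ /imsetP[i _ ->]; case: (unliftP ord0 i) => [j ->|->].
    by rewrite yl rowA.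
  by rewrite y0.
exists y, w; split=> // i j _.
move: Ycop; rewrite in_set => /andP[_ /eqP/matrixP/(_ i j)].
rewrite -!edge_y -!(row_edge_stack w) -!mulmx_dot -!row_mul.
by rewrite !mxE.
Qed.

Section CopyLower.
Variables (R : realType) (F : finFieldType) (d k : nat) (v : nat -> 'rV[F]_d).
Hypothesis F2 : 2%:R != 0 :> F.
Hypothesis k_lt_d : (k < d)%N.
Hypothesis gram_unit : gram (stack v k) \in unitmx.
Variables (A : {set 'rV[F]_d}) (alpha : R).
Local Notation q := #|F|.
Hypothesis cardA : #|A|%:R = alpha * q%:R ^+ d.
Hypothesis alpha_ge0 : 0 <= alpha.
Hypothesis alpha_le1 : alpha <= 1.
Hypothesis alpha_large : (2304 * 72 ^ k)%:R <= alpha ^+ k.+1 * q%:R ^+ (d - k).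

(** By [placed_step] each further vector costs a factor [12], and at most half of
    what is left is lost to dependent vectors. The constant [72] is [24 * 3], with
    the [3] from the upper bounds for numbers of copies. *)
Lemma card_placed_ge n : (n <= k)%N ->
  alpha ^+ n.+1 * (q ^ d * volume F d n)%:R <= 24%:R ^+ n * #|placed v A n|%:R.
Proof.
have q_gt0 : (0 < q)%N := ltnW (finNzRing_gt1 F).
have alpha_pow m : (m <= k)%N -> (2304 * 72 ^ k)%:R <= alpha ^+ m.+1 * q%:R ^+ (d - k).
  move=> m_le; apply: le_trans alpha_large _.
  by rewrite ler_wpM2r ?exprn_ge0 ?ler0n // ler_wiXn2l.
elim: n => [|n IH] n_lt.
  by rewrite mul1r (card_placed0 gram_unit) cardA /volume big_ord0 muln1 natrX expr1.
have {}IH := IH (ltnW n_lt).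
set V := volume F d n in IH; set N := #|placed v A n| in IH.
set N' := #|placed v A n.+1|; set D := (q ^ d)%N in IH *.
pose K := (q ^ (k - n.+1))%N; pose P := (q ^ (d - k))%N.
have QE : (q ^ (d - n.+1) = P * K)%N by rewrite -expnD; congr (_ ^ _)%N; lia.
have VS : volume F d n.+1 = (V * (P * K))%N by rewrite /volume big_ord_recr /= QE.
have cardA' : #|A|%:R = alpha * D%:R by rewrite cardA natrX.
have large m : (m <= k)%N -> (2304 * 72 ^ k)%:R <= alpha ^+ m.+1 * P%:R.
  by rewrite natrX; apply: alpha_pow.
have p24_gt0 m : 0 < 24%:R ^+ m :> R by rewrite exprn_gt0 ?ltr0n.
have eq_le_refl (x y : R) : x = y -> x <= y by move->.
have step : (2304 * 3 ^ n * V * K * (D * D) <= #|A| * (P * K) * N)%N.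
  rewrite -(ler_nat R) !natrM cardA' -(ler_pM2l (p24_gt0 n)).
  apply: (@le_trans _ _ (alpha * D%:R * (P%:R * K%:R) * (alpha ^+ n.+1 * (D * V)%:R))).
    have -> : 24%:R ^+ n * (2304%:R * (3 ^ n)%:R * V%:R * K%:R * (D%:R * D%:R)) =
        (2304 * 72 ^ n)%:R * (V * K * (D * D))%:R :> R.
      by rewrite (_ : 72 = 24 * 3)%N // expnMn !(natrM, natrX); ring.
    have -> : alpha * D%:R * (P%:R * K%:R) * (alpha ^+ n.+1 * (D * V)%:R) =
        alpha ^+ n.+2 * P%:R * (V * K * (D * D))%:R.
      by rewrite !natrM [alpha ^+ n.+2]exprS; ring.
    rewrite ler_wpM2r ?ler0n //; apply: le_trans (large _ n_lt).
    by rewrite ler_nat leq_mul2l leq_pexp2l // ltnW.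
  rewrite [leRHS](_ : _ = alpha * D%:R * (P%:R * K%:R) * (24%:R ^+ n * N%:R)); last by ring.
  by rewrite ler_wpM2l // ?mulr_ge0 ?ler0n.
have := placed_step F2 k_lt_d gram_unit n_lt; rewrite QE => /(_ A step).
rewrite -(ler_nat R) -/N -/N' -/D -/K !(natrD, natrM) cardA' => concl.
have aP : 24%:R <= alpha * P%:R.
  rewrite -[alpha]expr1; apply: le_trans (large 0%N (leq0n k)); rewrite ler_nat.
  by apply: (@leq_trans (2304 * 1)); rewrite // leq_mul2l expn_gt0.
have D_gt0 : 0 < D%:R :> R by rewrite ltr0n expn_gt0 q_gt0.
have le24 : alpha * (P%:R * K%:R) * N%:R <= 24%:R * N'%:R.
  have aPKN : 24%:R * (K%:R * N%:R) <= alpha * P%:R * (K%:R * N%:R).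
    by rewrite ler_wpM2r // -natrM ler0n.
  have : alpha * (P%:R * K%:R) * N%:R <= 12%:R * (N'%:R + N%:R * K%:R).
    rewrite -(ler_pM2l D_gt0); apply: le_trans (le_trans _ concl) _.
      by apply: eq_le_refl; ring.
    by apply: eq_le_refl; ring.
  move: aPKN; set x := alpha * _ * _; set y := alpha * _ * _.
  have -> : y = x by rewrite /x /y; ring.
  by lra.
rewrite VS exprS [24%:R ^+ n.+1]exprSr -[leLHS]mulrA -[leRHS]mulrA.
apply: le_trans (ler_wpM2l (ltW (p24_gt0 n)) le24).
have -> : alpha * (alpha ^+ n.+1 * (D%:R * (V * (P * K))%:R)) =
    alpha * (P%:R * K%:R) * (alpha ^+ n.+1 * (D * V)%:R) by rewrite !natrM; ring.
rewrite [leRHS](_ : _ = alpha * (P%:R * K%:R) * (24%:R ^+ n * N%:R)); last by ring.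
by rewrite ler_wpM2l // ?mulr_ge0 ?ler0n.
Qed.

End CopyLower.

Theorem corollary2 (R : realType) (k : nat) (hk : (1 <= k)%N) :
  exists2 C : R, 0 < C &
    forall (F : finFieldType) (hF : 2%N \notin [pchar F])
           (d : nat) (hd : (k < d)%N) (alpha : R)
           (halpha : C * (#|F|%:R `^ ((k%:R - d%:R) / (k%:R + 1))) <= alpha)
           (A : {set 'rV[F]_d}) (hA : #|A|%:R = alpha * #|F|%:R ^+ d)
           (D : {set 'rV[F]_d}),
      is_simplex k D -> full_rank k D ->
      exists D' : {set 'rV[F]_d},
        [/\ is_simplex k D', D' \subset A & isometric k D' D].
Proof.
case: k hk => [//|k] _; pose C : R := (2304 * 72 ^ k.+1)%:R.
have C_ge1 : 1 <= C by rewrite /C ler1n muln_gt0 expn_gt0.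
have C_gt0 : 0 < C := lt_le_trans ltr01 C_ge1.
exists C => // F hF d k_lt_d alpha halpha A cardA D simplexD [w wD rank_w].
have F2 : 2%:R != 0 :> F by move: hF; rewrite inE /=.
have gram_unit := gram_edges_unit simplexD wD rank_w.
have q_gt0 : 0 < #|F|%:R :> R by rewrite ltr0n (ltnW (finNzRing_gt1 F)).
have alpha_gt0 : 0 < alpha.
  by apply: lt_le_trans halpha; rewrite mulr_gt0 ?powR_gt0.
have alpha_le1 : alpha <= 1.
  rewrite -(ler_pM2r (exprn_gt0 d q_gt0)) mul1r -cardA -natrX ler_nat.
  by rewrite -card_rV max_card.
(* The hypothesis on [alpha], raised to the power [k + 1]. *)
have alpha_large : C <= alpha ^+ k.+2 * #|F|%:R ^+ (d - k.+1).
  apply: (@le_trans _ _ (C ^+ k.+2)); first by rewrite ler_eXnr.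
  have pow : (C * #|F|%:R `^ ((k.+1%:R - d%:R) / (k.+1%:R + 1))) ^+ k.+2 <= alpha ^+ k.+2.
    by rewrite lerXn2r ?nnegrE ?mulr_ge0 ?powR_ge0 ?(ltW C_gt0) ?(ltW alpha_gt0).
  have powM x : (#|F|%:R `^ x) ^+ k.+2 = #|F|%:R `^ (x * k.+2%:R) :> R.
    by rewrite powRrM powR_mulrn ?powR_ge0.
  rewrite exprMn powM in pow.
  have e1 : (k.+1%:R - d%:R) / (k.+1%:R + 1) * k.+2%:R = - (d - k.+1)%:R :> R.
    rewrite natrB ?(ltnW k_lt_d) // -[k.+2%:R]natr1 divfK ?opprB //.
    by rewrite natr1 pnatr_eq0.
  rewrite e1 powRN powR_mulrn ?(ltW q_gt0) // in pow.
  by rewrite -ler_pdivrMr ?exprn_gt0.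
have := card_placed_ge F2 k_lt_d gram_unit cardA (ltW alpha_gt0) alpha_le1 alpha_large (leqnn _).
have lhs_gt0 : 0 < alpha ^+ k.+2 * (#|F| ^ d * volume F d k.+1)%:R.
  rewrite mulr_gt0 ?exprn_gt0 // ltr0n muln_gt0 expn_gt0 (ltnW (finNzRing_gt1 F)) /=.
  by rewrite prodn_gt0 // => i; rewrite expn_gt0 (ltnW (finNzRing_gt1 F)).
move=> /(lt_le_trans lhs_gt0); rewrite pmulr_rgt0 ?exprn_gt0 ?ltr0n //.
by move=> /card_gt0P[z zP]; apply: placed_simplex zP wD.
Qed.
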